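(* Let $\mathcal{L}$ be a Lagrangian submanifold of $\mathbb{D}^n$ with non-degenerate induced metric. Then $\mathcal{L}$ is minimal if and only if it has constant Lagrangian angle.
   Context: $\mathbb{D}$ is the algebra of para-complex numbers $z=x+\tau y$, $x,y\in\mathbb{R}$, $\tau^2=1$, with conjugation $\overline{x+\tau y}=x-\tau y$ and squared norm $\langle z,z\rangle=z\bar z=x^2-y^2$; $z$ is null if $z\bar z=0$. If $z$ is non-null, its argument $\arg z$ is the unique real number $\theta$ such that $z=\pm\tau^q r e^{\tau\theta}=\pm\tau^q r(\cosh\theta+\tau\sinh\theta)$ for some choice of sign and some $q\in\{0,1\}$, where $r=|\langle z,z\rangle|^{1/2}$. On $\mathbb{D}^n$ with coordinates $z_j=x_j+\tau y_j$, $J(z_1,\ldots,z_n)=(\tau z_1,\ldots,\tau z_n)$, the metric is $\langle\cdot,\cdot\rangle=\sum_{j=1}^n (dx_j^2-dy_j^2)$, and the symplectic form is $\omega=\langle\cdot,J\cdot\rangle$. A submanifold $\mathcal{L}$ of $\mathbb{D}^n$ is Lagrangian if it has real dimension $n$ and $\omega$ vanishes on it. For a Lagrangian submanifold $\mathcal{L}$ with non-degenerate induced metric and a local orthonormal tangent frame $(e_1,\ldots,e_n)$, the para-holomorphic volume is $\Omega=\det_{\mathbb{D}}(e_1,\ldots,e_n)\in\mathbb{D}$ (the determinant over $\mathbb{D}$ of the $n\times n$ matrix whose rows are the vectors $e_i\in\mathbb{D}^n$), which is non-null. The Lagrangian angle is $\beta=\arg\Omega$, which does not depend on the frame. The mean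 curvature vector is given by $n\vec H=\sum_{i=1}^n\epsilon_i h(e_i,e_i)$, where $\epsilon_i=\langle e_i,e_i\rangle=\pm1$, $h(X,Y)=(D_XY)^\perp$, and $D$ is the flat connection of $\mathbb{D}^n$. $\mathcal{L}$ is minimal if it is a critical point of the volume functional attached to the metric, i.e. if $\vec H=0$.
   Formalization: The Lagrangian submanifold is assumed connected; otherwise the claim fails, since two disjoint flat Lagrangian pieces with different angles are minimal but have non-constant Lagrangian angle. *)

(* Defs.v *)
From HB Require Import structures.
From mathcomp Require Import all_boot all_order all_algebra.
From mathcomp Require Import all_classical all_reals all_analysis.
From mathcomp Require Import ring.

Set Implicit Arguments.
Unset Strict Implicit.
Unset Printing Implicit Defensive.

Import Order.TTheory GRing.Theory Num.Theory.
Import numFieldNormedType.Exports.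

Local Open Scope classical_set_scope.
Local Open Scope ring_scope.

Record paracomplex (R : Type) := ParaComplex { pRe : R; pIm : R }.

Definition pair_of_para (R : Type) (z : paracomplex R) : R * R :=
  (pRe z, pIm z).
Definition para_of_pair (R : Type) (z : R * R) : paracomplex R :=
  ParaComplex z.1 z.2.

Lemma pair_of_paraK (R : Type) :
  cancel (@pair_of_para R) (@para_of_pair R).
Proof. by case. Qed.

HB.instance Definition _ (R : choiceType) :=
  Choice.copy (paracomplex R) (can_type (@pair_of_paraK R)).

Definition para_zero (R : comNzRingType) : paracomplex R := ParaComplex 0 0.
Definition para_opp (R : comNzRingType) (z : paracomplex R) : paracomplex R :=
  ParaComplex (- pRe z) (- pIm z).
Definition para_add (R : comNzRingType) (z w : paracomplex R) :
    paracomplex R :=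
  ParaComplex (pRe z + pRe w) (pIm z + pIm w).
Definition para_one (R : comNzRingType) : paracomplex R := ParaComplex 1 0.
Definition para_mul (R : comNzRingType) (z w : paracomplex R) :
    paracomplex R :=
  ParaComplex (pRe z * pRe w + pIm z * pIm w) (pRe z * pIm w + pIm z * pRe w).

Lemma para_addA (R : comNzRingType) : associative (@para_add R).
Proof. by case=> a b [c d] [e f]; rewrite /para_add /= !addrA. Qed.

Lemma para_addC (R : comNzRingType) : commutative (@para_add R).
Proof. by case=> a b [c d]; congr ParaComplex; apply: addrC. Qed.

Lemma para_add0 (R : comNzRingType) : left_id (@para_zero R) (@para_add R).
Proof. by case=> a b; rewrite /para_add /= !add0r. Qed.

Lemma para_addN (R : comNzRingType) :
  left_inverse (@para_zero R) (@para_opp R) (@para_add R).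
Proof. by case=> a b; rewrite /para_add /= !addNr. Qed.

HB.instance Definition _ (R : comNzRingType) :=
  GRing.isZmodule.Build (paracomplex R)
    (@para_addA R) (@para_addC R) (@para_add0 R) (@para_addN R).

Lemma para_mulA (R : comNzRingType) : associative (@para_mul R).
Proof.
by case=> a b [c d] [e f]; congr ParaComplex => /=; ring.
Qed.

Lemma para_mulC (R : comNzRingType) : commutative (@para_mul R).
Proof.
case=> a b [c d]; rewrite /para_mul /=.
by congr ParaComplex; rewrite ?(mulrC c) ?(mulrC d) // addrC.
Qed.

Lemma para_mul1 (R : comNzRingType) : left_id (@para_one R) (@para_mul R).
Proof. by case=> a b; rewrite /para_mul /= !mul1r !mul0r !addr0. Qed.

Lemma para_mulDl (R : comNzRingType) :
  left_distributive (@para_mul R) (@para_add R).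
Proof.
by case=> a b [c d] [e f]; congr ParaComplex; rewrite /= !mulrDl addrACA.
Qed.

Lemma para_oner_neq0 (R : comNzRingType) : para_one R != para_zero R.
Proof. by apply/eqP=> -[] /eqP; rewrite oner_eq0. Qed.

HB.instance Definition _ (R : comNzRingType) :=
  GRing.Zmodule_isComNzRing.Build (paracomplex R)
    (@para_mulA R) (@para_mulC R) (@para_mul1 R) (@para_mulDl R)
    (@para_oner_neq0 R).

Definition para_tau (R : comNzRingType) : paracomplex R := ParaComplex 0 1.
Definition para_real (R : comNzRingType) (x : R) : paracomplex R :=
  ParaComplex x 0.
Definition para_conj (R : comNzRingType) (z : paracomplex R) : paracomplex R :=
  ParaComplex (pRe z) (- pIm z).

Definition para_sqnorm (R : comNzRingType) (z : paracomplex R) : R :=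
  pRe z ^+ 2 - pIm z ^+ 2.

Lemma para_sqnormE (R : comNzRingType) (z : paracomplex R) :
  z * para_conj z = para_real (para_sqnorm z).
Proof.
by case: z => a b; congr ParaComplex; rewrite /para_sqnorm /=; ring.
Qed.

(** [para_exp t] is $e^{\tau t} = \cosh t + \tau \sinh t$. *)
Definition para_exp (R : realType) (t : R) : paracomplex R :=
  ParaComplex ((expR t + expR (- t)) / 2) ((expR t - expR (- t)) / 2).

Definition is_para_arg (R : realType) (z : paracomplex R) (t : R) : Prop :=
  exists s q : bool,
    z = (-1) ^+ s * para_tau R ^+ q
        * para_real (Num.sqrt `|para_sqnorm z|) * para_exp t.

(** Only meaningful for non-null [z], where [is_para_arg z] holds of exactly
    one real number. *)
Definition para_arg (R : realType) (z : paracomplex R) : R :=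
  xget 0 [set t | is_para_arg z t].

(** A point $(x_j + \tau y_j)_j$ of D^n is encoded by the pair of real vectors
    $(x, y)$; this makes D^n a real normed space with the usual topology. *)
Definition Dspace (R : realType) (n : nat) : normedModType R :=
  ('rV[R]_n * 'rV[R]_n)%type.

Definition Dcoord (R : realType) (n : nat) (z : Dspace R n) (j : 'I_n) :
    paracomplex R :=
  ParaComplex (z.1 ord0 j) (z.2 ord0 j).

(** Since $\tau (x + \tau y) = y + \tau x$, this is multiplication by $\tau$ in
    each coordinate. *)
Definition paraJ (R : realType) (n : nat) (z : Dspace R n) : Dspace R n :=
  (z.2, z.1).

Lemma paraJE (R : realType) (n : nat) (z : Dspace R n) (j : 'I_n) :
  Dcoord (paraJ z) j = para_tau R * Dcoord z j.
Proof. by congr ParaComplex; rewrite /= !mul0r mul1r ?add0r. Qed.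

Definition Dmetric (R : realType) (n : nat) (v w : Dspace R n) : R :=
  \sum_(j < n) (v.1 ord0 j * w.1 ord0 j - v.2 ord0 j * w.2 ord0 j).

Definition Domega (R : realType) (n : nat) (v w : Dspace R n) : R :=
  Dmetric v (paraJ w).

Fixpoint iter_derive (R : realType) (V W : normedModType R) (vs : seq V)
    (f : V -> W) : V -> W :=
  if vs is v :: vs' then 'D_v (iter_derive vs' f) else f.

(** For [U] open in a finite-dimensional space this is C^oo regularity. *)
Definition smooth_on (R : realType) (V W : normedModType R) (U : set V)
    (f : V -> W) : Prop :=
  forall (vs : seq V) (u : V), U u -> differentiable (iter_derive vs f) u.

(** A submanifold is given by a (not necessarily injective) immersion
    [F : M -> D^n] of an abstract manifold; an embedded submanifold is the case
    where [M] is a subset of D^n with its subspace topology and [F] is the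
    inclusion.  As [F] is an immersion, the smooth structure of [M] is determined
    by [F]: its charts (taken here in the direction R^k -> M) are the
    homeomorphisms [phi] from an open set [U] of R^k onto an open set of [M] for
    which [F \o phi] is a smooth immersion.  The values of [phi] outside [U] are
    irrelevant. *)
Definition is_chart (R : realType) (n k : nat) (M : topologicalType)
    (F : M -> Dspace R n) (U : set 'rV[R]_k) (phi : 'rV[R]_k -> M) : Prop :=
  [/\ open U,
      forall u, U u -> {for u, continuous phi},
      forall u v, U u -> U v -> phi u = phi v -> u = v,
      forall A, open A -> A `<=` U -> open (phi @` A) &
      smooth_on U (F \o phi) /\
      forall u, U u -> injective ('d (F \o phi) u)].

Definition is_submanifold (R : realType) (n k : nat) (M : topologicalType)
    (F : M -> Dspace R n) : Prop :=
  [/\ hausdorff_space M, @second_countable M &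
      forall p : M, exists (U : set 'rV[R]_k) (phi : 'rV[R]_k -> M) u,
        [/\ is_chart F U phi, U u & phi u = p]].

Definition tangent (R : realType) (n k : nat) (M : topologicalType)
    (F : M -> Dspace R n) (p : M) : set (Dspace R n) :=
  [set X | exists (U : set 'rV[R]_k) (phi : 'rV[R]_k -> M) u w,
     [/\ is_chart F U phi, U u, phi u = p & 'd (F \o phi) u w = X]].

Definition normal (R : realType) (n k : nat) (M : topologicalType)
    (F : M -> Dspace R n) (p : M) : set (Dspace R n) :=
  [set N | forall X, tangent k F p X -> Dmetric N X = 0].

Definition nondegenerate_metric (R : realType) (n k : nat)
    (M : topologicalType) (F : M -> Dspace R n) : Prop :=
  forall p X, tangent k F p X ->
    (forall Y, tangent k F p Y -> Dmetric X Y = 0) -> X = 0.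

Definition is_lagrangian (R : realType) (n : nat) (M : topologicalType)
    (F : M -> Dspace R n) : Prop :=
  is_submanifold n F /\
  forall p X Y, tangent n F p X -> tangent n F p Y -> Domega X Y = 0.

(** $v^\perp$: well defined as D^n is the direct sum of the tangent and normal
    spaces at [p] when the induced metric is non-degenerate. *)
Definition normal_part (R : realType) (n k : nat) (M : topologicalType)
    (F : M -> Dspace R n) (p : M) (v : Dspace R n) : Dspace R n :=
  xget 0 [set N | normal k F p N /\ tangent k F p (v - N)].

Definition tangent_field (R : realType) (n k : nat) (M : topologicalType)
    (F : M -> Dspace R n) (U : set 'rV[R]_k) (phi : 'rV[R]_k -> M)
    (Y : 'rV[R]_k -> Dspace R n) : Prop :=
  smooth_on U Y /\ forall u, U u -> tangent k F (phi u) (Y u).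

(** $h(X, Y) = (D_X Y)^\perp$ at [p], for tangent vectors [X] and [Y] at [p]: the
    vector [Y] is extended to a local tangent vector field [Yt] read in a chart,
    and [X] is the image of the coordinate vector [w].  The value does not depend
    on the chart or the extension. *)
Definition second_form (R : realType) (n k : nat) (M : topologicalType)
    (F : M -> Dspace R n) (p : M) (X Y : Dspace R n) : Dspace R n :=
  xget 0 [set N | exists (U : set 'rV[R]_k) (phi : 'rV[R]_k -> M) u w
                         (Yt : 'rV[R]_k -> Dspace R n),
     [/\ is_chart F U phi, U u & phi u = p] /\
     [/\ 'd (F \o phi) u w = X, tangent_field F U phi Yt, Yt u = Y &
         N = normal_part k F p ('D_w Yt u)]].

(** The orthogonality relations force linear independence, so that [e] is a basis
    of the [k]-dimensional tangent space. *)
Definition orthonormal_frame (R : realType) (n k : nat) (M : topologicalType)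
    (F : M -> Dspace R n) (p : M) (e : 'I_k -> Dspace R n) : Prop :=
  [/\ forall i, tangent k F p (e i),
      forall i, Dmetric (e i) (e i) = 1 \/ Dmetric (e i) (e i) = -1 &
      forall i j, i != j -> Dmetric (e i) (e j) = 0].

(** The vector determined by any orthonormal frame at [p]. *)
Definition mean_curvature (R : realType) (n k : nat) (M : topologicalType)
    (F : M -> Dspace R n) (p : M) : Dspace R n :=
  xget 0 [set H | exists e : 'I_k -> Dspace R n, orthonormal_frame F p e /\
     H = k%:R^-1 *:
       \sum_(i < k) Dmetric (e i) (e i) *: second_form k F p (e i) (e i)].

Definition is_minimal (R : realType) (n k : nat) (M : topologicalType)
    (F : M -> Dspace R n) : Prop :=
  forall p, mean_curvature k F p = 0.

Definition para_volume (R : realType) (n : nat) (e : 'I_n -> Dspace R n) :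
    paracomplex R :=
  \det (\matrix_(i < n, j < n) Dcoord (e i) j).

(** The number determined by any orthonormal frame at [p]. *)
Definition lagrangian_angle (R : realType) (n : nat) (M : topologicalType)
    (F : M -> Dspace R n) (p : M) : R :=
  xget 0 [set t | exists e : 'I_n -> Dspace R n, orthonormal_frame F p e /\
     t = para_arg (para_volume e)].

(* Main.v *)
From HB Require Import structures.
From mathcomp Require Import all_boot all_order all_algebra.
From mathcomp Require Import all_classical all_reals all_analysis.
From mathcomp Require Import perm ring lra.
Require Import Defs.

Set Implicit Arguments.
Unset Strict Implicit.
Unset Printing Implicit Defensive.

Import Order.TTheory GRing.Theory Num.Theory.
Import numFieldNormedType.Exports.

Local Open Scope classical_set_scope.
Local Open Scope ring_scope.

(** Null coordinates diagonalize the para-complex structure.  Sending [tau] to 1 and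
    to -1 identifies D with R x R, so a chart [f] of the submanifold becomes a pair
    of maps [f+], [f-] from an open set of R^n to R^n, with Jacobian matrices [Ap]
    and [Am].  The metric pairs [+] components with [-] components, and the
    submanifold is Lagrangian exactly when the matrix [G = Ap Am^T] is symmetric;
    [G] is then the Gram matrix of the induced metric, so that [Ap] and [Am] are
    invertible when the metric is non-degenerate.

    The para-holomorphic volume of the coordinate frame has null components
    [\det Ap] and [\det Am], and the argument of a non-null number depends only on
    the ratio of its null components; so the Lagrangian angle is
    [ln |\det Ap / \det Am| / 2] ([lagrangian_angleE]).  By Jacobi's formula its
    derivative along [z] is half of
    [\tr (Bp Ap^-1) - \tr (Bm Am^-1)], where [Bp] and [Bm] are the derivatives of
    [Ap] and [Am] along [z]; by symmetry of second derivatives they are also the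
    Jacobians of the derivative of [f] along [z] ([derive_jac]).

    On the other side, if [Y] is a tangent field then [omega(Y, D_z f) = 0];
    differentiating along [X] expresses the second fundamental form by
    [omega(h(X, Y), D_z f) = - omega(Y, D_X D_z f)] ([second_form_pairing]).  Taking
    the trace over an orthonormal frame, that is, against [G^-1], gives exactly
    [omega(n H, D_z f) = - d beta(z)] ([mean_curvature_pairing]).  A normal vector
    that is [omega]-orthogonal to the tangent space vanishes, so [H = 0] if and only
    if the angle has zero derivative, and on a connected manifold this means that
    the angle is constant.

    Different charts are compared through their transition maps
    ([chart_transition]): differentiability of these maps at each point makes the
    tangent space and the second fundamental form independent of the chart. *)

(** * Mean values and symmetry of second derivatives *)

Section Calculus.
Context {R : realType}.

Lemma is_derive_line (V W : normedModType R) (f : V -> W) (x v : V) (t : R) :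
  derivable f (x + t *: v) v ->
  is_derive t 1 (fun s : R => f (x + s *: v)) ('D_v f (x + t *: v)).
Proof.
move=> df.
suff E : (fun h : R => h^-1 *: (((fun s : R => f (x + s *: v)) \o shift t) (h *: 1)
             - f (x + t *: v)))
       = (fun h => h^-1 *: ((f \o shift (x + t *: v)) (h *: v) - f (x + t *: v))).
  by apply: DeriveDef; rewrite /derivable /derive E.
apply/funext => h /=; congr (_ *: (f _ - _)).
by rewrite [h *: 1]mulr1 scalerDl addrCA.
Qed.

Lemma MVT_line (V : normedModType R) (f : V -> R) (x v : V) (h : R) :
  0 < h -> (forall t, 0 <= t <= h -> derivable f (x + t *: v) v) ->
  exists2 c, 0 <= c <= h & f (x + h *: v) - f x = h * 'D_v f (x + c *: v).
Proof.
move=> h0 df.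
have [||c ci] := @MVT R (fun s : R => f (x + s *: v))
   (fun s => 'D_v f (x + s *: v)) 0 h h0.
- move=> t; rewrite in_itv /= => /andP[? ?].
  by apply: is_derive_line; apply: df; rewrite !ltW.
- apply: derivable_within_continuous => t; rewrite in_itv /= => ti.
  exact: (@ex_derive _ _ _ _ _ _ _ (is_derive_line (df t ti))).
rewrite scale0r addr0 subr0 mulrC => E; exists c => //.
by move: ci; rewrite in_itv /= => /andP[? ?]; rewrite !ltW.
Qed.

Lemma derive_linear_comp (U V W : normedModType R) (l : {linear V -> W})
    (f : U -> V) (x v : U) : continuous l -> differentiable f x ->
  differentiable (l \o f) x /\ 'D_v (l \o f) x = l ('D_v f x).
Proof.
move=> cl df; have dl y : differentiable l y by exact: linear_differentiable.
have dlf : differentiable (l \o f) x by exact: differentiable_comp.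
by split=> //; rewrite !deriveE // diff_comp //= diff_lin.
Qed.

Lemma MVT_line_linear (V W : normedModType R) (l : {linear W -> R}) (f : V -> W)
    (x v : V) (h : R) : continuous l ->
  0 < h -> (forall t, 0 <= t <= h -> differentiable f (x + t *: v)) ->
  exists2 c, 0 <= c <= h & l (f (x + h *: v)) - l (f x) = h * l ('D_v f (x + c *: v)).
Proof.
move=> cl h0 df.
have [t th|c ch E] := @MVT_line V (l \o f) x v h h0.
  by apply: diff_derivable; exact: (derive_linear_comp v cl (df t th)).1.
by exists c => //; rewrite -(derive_linear_comp v cl (df c ch)).2.
Qed.

(** The mean value theorem applied twice: along [v] to the increment
    [f (x + h *: w) - f x], and then along [w] to ['D_v f].  Exchanging [v] and
    [w] leaves the left-hand side unchanged, which is what makes second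
    derivatives symmetric.  Mean value theorems are scalar, hence the functional
    [l]: the intermediate point depends on it. *)
Lemma second_difference (V W : normedModType R) (l : {linear W -> R}) (f : V -> W)
    (U : set V) (u v w : V) (h : R) : continuous l -> 0 < h ->
  (forall s t, 0 <= s <= h -> 0 <= t <= h -> U (u + s *: v + t *: w)) ->
  (forall x, U x -> differentiable f x) ->
  (forall x, U x -> differentiable ('D_v f) x) ->
  exists s t, [/\ 0 <= s <= h, 0 <= t <= h &
   l (f (u + h *: v + h *: w)) - l (f (u + h *: v)) - l (f (u + h *: w)) + l (f u)
   = h * h * l ('D_w ('D_v f) (u + s *: v + t *: w))].
Proof.
move=> cl h0 Uh df ddf; have hh : 0 <= h <= h by rewrite (ltW h0) lexx.
have h00 : 0 <= (0 : R) <= h by rewrite lexx ltW.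
have Uh0 s : 0 <= s <= h -> U (u + s *: v).
  by move=> sh; have := Uh s 0 sh h00; rewrite scale0r addr0.
pose fw x := f (x + h *: w); pose g x := fw x - f x.
have Uw s : 0 <= s <= h -> U (u + s *: v + h *: w) by move=> ?; exact: Uh.
have dsh x : U (x + h *: w) -> differentiable fw x.
  move=> Ux; apply: (@differentiable_comp _ _ _ _ (fun x => x + h *: w)) => //.
  exact: df.
have dshE x : U (x + h *: w) -> 'D_v fw x = 'D_v f (x + h *: w).
  move=> Ux; rewrite !deriveE//; [|exact: df|exact: dsh].
  rewrite (_ : fw = f \o (fun x => x + h *: w))// diff_comp//=; last exact: df.
  congr ('d f _ _).
  have -> : 'd (fun x0 : V => x0 + h *: w) x = id :> (V -> V).
    have := is_diffD (is_diff_id x) (is_diff_cst (h *: w) x).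
    by rewrite addr0 => -[].
  by [].
have dg t : 0 <= t <= h -> differentiable g (u + t *: v).
  move=> th; apply: differentiableB; first by apply: dsh; exact: Uw.
  by apply: df; exact: Uh0.
have [s sh Es] := @MVT_line_linear V W l g u v h cl h0 dg.
have Dg : 'D_v g (u + s *: v) =
   'D_v f (u + s *: v + h *: w) - 'D_v f (u + s *: v).
  rewrite -dshE; last exact: Uw.
  rewrite -deriveB //; apply: diff_derivable; first by apply: dsh; exact: Uw.
  by apply: df; exact: Uh0.
have [t th|t th Et] := @MVT_line_linear V W l ('D_v f) (u + s *: v) w h cl h0.
  by apply: ddf; exact: Uh.
exists s, t; split=> //.
have Dl := congr1 l Dg; rewrite (linearB l) in Dl.
rewrite -mulrA -Et -Dl -Es.
by rewrite /g /fw !linearB /=; ring.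
Qed.

Lemma near_parallelogram (V : normedModType R) (u v w : V) (P : set V) :
  nbhs u P -> exists2 d : R, 0 < d & forall s t, 0 <= s <= d -> 0 <= t <= d ->
    P (u + s *: v + t *: w).
Proof.
move=> /nbhs_ballP[e /= e0 eP].
(* the constant 1 keeps K positive when v and w vanish *)
pose K := 1 + `|v| + `|w|.
have K0 : 0 < K by rewrite /K -addrA ltr_pwDl // addr_ge0.
exists (e / 2 / K); first by rewrite !divr_gt0.
have P1 s (x : V) : 0 <= s <= e / 2 / K -> `|s *: x| <= e / 2 / K * `|x|.
  by move=> /andP[s0 s1]; rewrite normrZ ger0_norm // ler_wpM2r.
move=> s t si ti; apply: eP; rewrite -ball_normE /ball_ /=.
rewrite -addrA opprD addNKr normrN.
apply: (le_lt_trans (ler_normD _ _)).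
apply: (le_lt_trans (lerD (P1 _ _ si) (P1 _ _ ti))).
rewrite -mulrDr.
have -> : `|v| + `|w| = K - 1 by rewrite /K; ring.
rewrite mulrBr mulr1 divfK ?gt_eqF //.
have : 0 < e / 2 / K by rewrite !divr_gt0.
lra.
Qed.

Lemma dist_le_half (a b c d e : R) :
  `|a - c| < e / 2 -> `|b - d| < e / 2 -> c = d -> `|a - b| <= e.
Proof.
move=> ac + cd; rewrite -cd => bc; rewrite (splitr e) -(subrKA c).
apply: (le_trans (ler_normD _ _)).
by rewrite (distrC c) lerD // ltW.
Qed.

(** Clairaut-Schwarz: at scale [d] both mixed derivatives, taken at two
    intermediate points of the same small parallelogram, equal the second
    difference divided by [d * d]; continuity at [u] lets [d] tend to zero. *)
Lemma derive_symmetric (V W : normedModType R) (l : {linear W -> R}) (f : V -> W)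
    (U : set V) (u v w : V) :
  continuous l -> open U -> U u -> smooth_on U f ->
  l ('D_w ('D_v f) u) = l ('D_v ('D_w f) u).
Proof.
move=> cl oU Uu sf.
have df x : U x -> differentiable f x by move=> Ux; exact: sf [::] x Ux.
have dvf x : U x -> differentiable ('D_v f) x by move=> Ux; exact: sf [:: v] x Ux.
have dwf x : U x -> differentiable ('D_w f) x by move=> Ux; exact: sf [:: w] x Ux.
have cont a b : {for u, continuous (l \o 'D_a ('D_b f))}.
  apply: differentiable_continuous; apply: differentiable_comp.
    exact: sf [:: a; b] u Uu.
  exact: linear_differentiable.
apply/eqP; rewrite -subr_eq0 -normr_le0; apply/ler_addgt0Pr => e e0; rewrite add0r.
have e20 : 0 < e / 2 by rewrite divr_gt0.
(* the intermediate points are close enough to u for an error of e *)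
pose P1 := [set x | U x /\ `|l ('D_w ('D_v f) u) - l ('D_w ('D_v f) x)| < e / 2
   /\ `|l ('D_v ('D_w f) u) - l ('D_v ('D_w f) x)| < e / 2].
have nP1 : nbhs u P1.
  have nU : nbhs u U by move: oU; rewrite openE; apply.
  have /cvgrPdist_lt /(_ _ e20) n1 := cont w v.
  have /cvgrPdist_lt /(_ _ e20) n2 := cont v w.
  exact: filterI nU (filterI n1 n2).
have [d d0 dP] := near_parallelogram v w nP1.
have [s [t [sd td E1]]] := @second_difference V W l f U u v w d cl d0
  (fun s t hs ht => proj1 (dP s t hs ht)) df dvf.
have [|s' [t' [sd' td' E2]]] := @second_difference V W l f U u w v d cl d0 _ df dwf.
  by move=> a b ha hb; rewrite addrAC; exact: (proj1 (dP b a hb ha)).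
have E : l ('D_w ('D_v f) (u + s *: v + t *: w)) =
         l ('D_v ('D_w f) (u + t' *: v + s' *: w)).
  move: E1 E2; rewrite (addrAC u (s' *: w)) (addrAC u (d *: w)).
  move: ('D_w _ _) ('D_v _ _) => a b E1 E2.
  have dd0 : d * d != 0 by rewrite mulf_neq0 // gt_eqF.
  by apply: (mulfI dd0); rewrite -E1 -E2; ring.
have [_ [A1 _]] := dP s t sd td.
have [_ [_ A2]] := dP t' s' td' sd'.
exact: dist_le_half A1 A2 E.
Qed.

Lemma derive0_near_cst (V : normedModType R) (f : V -> R) (U : set V) (u : V) :
  open U -> U u -> (forall x v, U x -> is_derive x v f 0) ->
  \forall x \near u, f x = f u.
Proof.
move=> oU Uu df0.
have : nbhs u U by move: oU; rewrite openE; apply.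
move=> /nbhs_ballP[e /= e0 eU]; apply/nbhs_ballP; exists e => //= x ux.
have Ut t : 0 <= t <= 1 -> U (u + t *: (x - u)).
  move=> /andP[t0 t1]; apply/eU; move: ux; rewrite -!ball_normE /ball_ /=.
  rewrite opprD addNKr normrN normrZ ger0_norm // distrC => ux.
  by apply: le_lt_trans ux; rewrite ler_piMl.
have [t /Ut /(df0 _ (x - u)) [] //|c /Ut cU] := @MVT_line V f u (x - u) 1 ltr01.
rewrite scale1r subrKC mul1r (@derive_val _ _ _ _ _ _ _ (df0 _ _ cU)) => /eqP.
by rewrite subr_eq0 => /eqP.
Qed.

End Calculus.

(** * Derivative of the determinant *)

Section Determinant.
Context {R : realType} {V : normedModType R}.

Lemma is_derive_big_sum (I : Type) (r : seq I) (f : I -> V -> R) (df : I -> R) x v :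
  (forall i, is_derive x v (f i) (df i)) ->
  is_derive x v (fun y => \sum_(i <- r) f i y) (\sum_(i <- r) df i).
Proof.
move=> h; elim: r => [|a r IH].
  rewrite (_ : (fun _ => _) = cst 0) ?big_nil; first exact: is_derive_cst.
  by apply/funext => y; rewrite big_nil.
rewrite (_ : (fun _ => _) = f a + (fun y => \sum_(i <- r) f i y)).
  by rewrite big_cons; apply: is_deriveD.
by apply/funext => y; rewrite big_cons.
Qed.

Lemma is_derive_big_prod (I : eqType) (r : seq I) (f : I -> V -> R) (df : I -> R) x v :
  uniq r -> (forall i, is_derive x v (f i) (df i)) ->
  is_derive x v (fun y => \prod_(i <- r) f i y)
    (\sum_(i <- r) df i * \prod_(j <- r | j != i) f j x).
Proof.
move=> + h; elim: r => [|a r IH] /=.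
  move=> _; rewrite (_ : (fun _ => _) = cst 1) ?big_nil; first exact: is_derive_cst.
  by apply/funext => y; rewrite big_nil.
move=> /andP[ar /IH {}IH].
rewrite (_ : (fun _ => _) = f a * (fun y => \prod_(i <- r) f i y)); last first.
  by apply/funext => y; rewrite big_cons.
apply: is_derive_eq; rewrite big_cons big_cons eqxx addrC /=; congr (_ + _).
  rewrite [LHS]mulrC; congr (_ * _); rewrite [RHS]big_mkcond.
  apply: eq_big_seq => i ir; rewrite ifT //.
  by apply: contraNneq ar => <-.
rewrite [LHS]mulr_sumr; apply: eq_big_seq => i ir.
rewrite big_cons mulrCA.
by rewrite (_ : a != i) //; apply: contraNneq ar => ->.
Qed.

(** Jacobi's formula.  It comes from the Leibniz expansion: the terms where row
    [i] is differentiated sum to a determinant, and expanding that determinant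
    along row [i] meets the same cofactors as those of [A]. *)
Lemma is_derive_det n (A : V -> 'M[R]_n) x v :
  derivable A x v ->
  is_derive x v (fun y => \det (A y)) (\tr ('D_v A x *m \adj (A x))).
Proof.
move=> dA; have dAij i j : is_derive x v (fun y => A y i j) ('D_v A x i j).
  by apply: DeriveDef; [exact: ((derivable_mxP _ _ _).1 dA)|rewrite derive_mx // mxE].
have H (s : {perm 'I_n}) : is_derive x v
    (fun y => (-1) ^+ s * \prod_(i <- index_enum 'I_n) A y i (s i))
    ((-1) ^+ s * \sum_(i <- index_enum 'I_n) 'D_v A x i (s i) *
        \prod_(j <- index_enum 'I_n | j != i) A x j (s j)).
  rewrite (_ : (fun _ => _) = ((-1) ^+ s : R) \*:
    (fun y => \prod_(i <- index_enum 'I_n) A y i (s i))) //.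
  apply: is_deriveZ; apply: is_derive_big_prod; exact: index_enum_uniq.
refine (is_derive_eq (is_derive_big_sum (index_enum _) H) _).
rewrite /mxtrace.
under eq_bigr do rewrite mulr_sumr.
rewrite exchange_big /=; apply: eq_bigr => i _.
(* differentiating only row i gives the determinant of A with row i replaced *)
pose B := \matrix_(a, b) if a == i then 'D_v A x a b else A x a b.
transitivity (\det B).
  rewrite /determinant; apply: eq_bigr => s _; congr (_ * _).
  rewrite [RHS](bigD1 i) //= mxE eqxx; congr (_ * _); apply: eq_bigr => j ji.
  by rewrite mxE (negbTE ji).
rewrite (expand_det_row B i) mxE; apply: eq_bigr => j _.
rewrite !mxE eqxx; congr (_ * ((-1) ^+ _ * \det _)).
by apply/matrixP => a b; rewrite !mxE eq_sym (negbTE (neq_lift _ _)).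
Qed.

End Determinant.

(** * Linear maps on row vectors and local inverses *)

Section LinearMaps.
Context {R : realType}.

Lemma linear_rV_continuous n (W : normedModType R) (f : {linear 'rV[R]_n -> W}) :
  continuous f.
Proof.
move=> x; have -> : (f : _ -> _) =
    \sum_i (fun y : 'rV[R]_n => y 0 i *: f (delta_mx 0 i)).
  apply/funext => y; rewrite {1}(row_sum_delta y) linear_sum fct_sumE.
  by apply: eq_bigr => i _; rewrite linearZ.
apply: differentiable_continuous; apply: differentiable_sum => i.
by apply: differentiableZl; exact: differentiable_coord.
Qed.

(** Stacking the two components turns [A] into right multiplication by a matrix
    of full row rank, which has a right inverse. *)
Lemma linear_rV_left_inverse n m
    (A : {linear 'rV[R]_n -> ('rV[R]_m * 'rV[R]_m)%type}) :
  injective A -> exists2 P : {linear ('rV[R]_m * 'rV[R]_m)%type -> 'rV[R]_n},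
    continuous P & cancel A P.
Proof.
move=> injA.
have linB : linear (fun x => row_mx (A x).1 (A x).2).
  by move=> a x y; rewrite linearP /= scale_row_mx add_row_mx.
pose lB := GRing.isLinear.Build _ _ _ _ _ linB.
pose B : {linear _ -> _} := HB.pack (fun x => row_mx (A x).1 (A x).2) lB.
have freeB : row_free (lin1_mx B).
  rewrite -kermx_eq0; apply/rowV0P => x /sub_kermxP.
  rewrite mul_rV_lin1 /= => /eqP; rewrite row_mx_eq0 => /andP[/eqP A1 /eqP A2].
  by apply: injA; rewrite linear0; case: (A x) A1 A2 => /= a b -> ->.
pose C := pinvmx (lin1_mx B).
have linP : linear (fun z : 'rV[R]_m * 'rV[R]_m => z.1 *m usubmx C + z.2 *m dsubmx C).
  by move=> a x y /=; rewrite !mulmxDl -!scalemxAl scalerDr addrACA.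
pose lP := GRing.isLinear.Build _ _ _ _ _ linP.
pose P : {linear _ -> _} :=
  HB.pack (fun z : 'rV[R]_m * 'rV[R]_m => z.1 *m usubmx C + z.2 *m dsubmx C) lP.
exists P.
  move=> z; apply: cvgD.
    apply: (@continuous_comp _ _ _ fst (mulmxr (usubmx C))); first exact: cvg_fst.
    exact: linear_rV_continuous.
  apply: (@continuous_comp _ _ _ snd (mulmxr (dsubmx C))); first exact: cvg_snd.
  exact: linear_rV_continuous.
move=> x /=; rewrite -mul_row_col vsubmxK.
have -> : row_mx (A x).1 (A x).2 = x *m lin1_mx B by rewrite mul_rV_lin1.
by rewrite mulmxKp.
Qed.

(** Continuity of [h] puts [h y] in the range where [p] is close to a translation,
    so the increments of [h] and of [q = p \o h] agree up to a term of lower order;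
    hence [h] has the same differential as [q]. *)
Lemma differentiable_local_inverse (U V : normedModType R)
    (p : V -> V) (q h : U -> V) (x : U) :
  {for x, continuous h} -> differentiable p (h x) -> 'd p (h x) = id :> (V -> V) ->
  differentiable q x -> (\forall y \near x, p (h y) = q y) -> differentiable h x.
Proof.
move=> ch dp dp1 dq phq.
have cdq := diff_continuous dq.
suff E : h \o shift x = cst (h x) + 'd q x +o_ 0 id.
  by apply/diff_locallyP; rewrite (diff_unique cdq E).
have [K K0 lipK] := linear_lipschitz cdq.
apply/eqaddoP => _ /posnumP[e].
(* [c <= 1 / 2] absorbs the error term in D on the right of Da, which gives
   |D| <= (1 + 2 K) |y|; the second bound on c then makes the total error
   c (2 + 2 K) |y| at most e |y| *)
pose c := Num.min (1 / 2) (e%:num / (2 + 2 * K)).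
have K2 : 0 < 2 + 2 * K by lra.
have c0 : 0 < c by rewrite lt_min !divr_gt0.
have c1 : c <= 1 / 2 by rewrite ge_min lexx.
have c2 : c * (2 + 2 * K) <= e%:num by rewrite -ler_pdivlMr // ge_min lexx orbT.
have shx : shift x y @[y --> 0] --> x.
  by rewrite -[X in _ --> X]add0r; apply: cvgD; [exact: cvg_id|exact: cvg_cst].
have phx := nbhs_singleton phq.
have /eqaddoP /(_ _ c0) Hp := diff_locally dp.
have /eqaddoP /(_ _ c0) Hq := diff_locally dq.
have hx0 : (h (y + x) - h x) @[y --> 0] --> (0 : V).
  rewrite -(subrr (h x)); apply: cvgB; last exact: cvg_cst.
  exact: (cvg_comp _ _ shx ch).
have Hp' := hx0 _ Hp.
have phq' := shx _ phq.
near=> y.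
have yp : p (h (y + x)) = q (y + x) by near: y; exact: phq'.
have yq : `|(q \o shift x - (cst (q x) + 'd q x)) y| <= c * `|y| by near: y; exact: Hq.
have yh : `|(p \o shift (h x) - (cst (p (h x)) + 'd p (h x))) (h (y + x) - h x)|
    <= c * `|h (y + x) - h x|.
  by near: y; exact: Hp'.
move: yq yh.
rewrite -![(_ - _ : _ -> _) _]/(_ - _) -![(_ + _ : _ -> _) _]/(_ + _) /=.
rewrite subrK dp1 yp phx /=.
rewrite (opprD (h x)) (addrA (h (y + x))).
move: (h (y + x) - h x) => D; rewrite !opprD !addrA.
set a := q (y + x) - q x => yq yh.
have Da : `|D - 'd q x y| <= c * `|D| + c * `|y|.
  rewrite -(subrKA a D); apply: le_trans (ler_normD _ _) _.
  by rewrite (distrC D) lerD.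
have : `|D| <= `|D - 'd q x y| + K * `|y|.
  rewrite -{1}(subrK ('d q x y) D); apply: le_trans (ler_normD _ _) _.
  by rewrite lerD.
move: (normr_ge0 D) (normr_ge0 y) Da; move: `|D| `|y| `|D - _| => d t r d0 t0 Da dr.
have dt : d <= (1 + 2 * K) * t.
  have cd : c * d <= 1 / 2 * d by rewrite ler_wpM2r.
  have ct : c * t <= 1 / 2 * t by rewrite ler_wpM2r.
  lra.
apply: le_trans Da _; rewrite -mulrDr.
apply: (@le_trans _ _ (c * ((2 + 2 * K) * t))); last by rewrite mulrA ler_wpM2r.
by rewrite ler_pM2l //; lra.
Unshelve. all: by end_near. Qed.

End LinearMaps.

(** * Jacobian matrices of smooth maps *)

Section Jacobian.
Context {R : realType} {n m : nat} {W : normedModType R}.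

(** The Jacobian matrix of [l \o f] when [l] is linear; row vectors act on the left,
    see [jacP].  It is defined by directional derivatives of [f] so that it can be
    differentiated entrywise. *)
Definition jac (l : W -> 'rV[R]_m) (f : 'rV[R]_n -> W) (u : 'rV[R]_n) :
    'M[R]_(n, m) :=
  \matrix_(i, j) l ('D_(delta_mx 0 i) f u) 0 j.

Lemma jacP (l : {linear W -> 'rV[R]_m}) (f : 'rV[R]_n -> W) u x :
  differentiable f u -> l ('D_x f u) = x *m jac l f u.
Proof.
move=> df; rewrite deriveE //.
have -> : 'd f u x = 'd f u (\sum_i x 0 i *: delta_mx 0 i).
  by rewrite -row_sum_delta.
rewrite !linear_sum; apply/rowP => j; rewrite summxE mxE; apply: eq_bigr => i _.
by rewrite !linearZ /= !mxE deriveE.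
Qed.

Lemma smooth_on_differentiable (U : set 'rV[R]_n) (f : 'rV[R]_n -> W) u :
  smooth_on U f -> U u -> differentiable f u.
Proof. by move=> sf Uu; exact: sf [::] u Uu. Qed.

(** The innermost derivative of [iter_derive] is the last of the list. *)
Lemma smooth_on_derive (U : set 'rV[R]_n) (f : 'rV[R]_n -> W) z :
  smooth_on U f -> smooth_on U ('D_z f).
Proof.
move=> sf vs u Uu; have := sf (rcons vs z) u Uu.
suff -> : iter_derive (rcons vs z) f = iter_derive vs ('D_z f) by [].
by elim: vs => //= v vs ->.
Qed.

(** Entrywise, this is the symmetry of second derivatives. *)
Lemma derive_jac (l : {linear W -> 'rV[R]_m}) (U : set 'rV[R]_n)
    (f : 'rV[R]_n -> W) u z : continuous l -> open U -> U u -> smooth_on U f ->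
  derivable (jac l f) u z /\ 'D_z (jac l f) u = jac l ('D_z f) u.
Proof.
move=> cl oU Uu sf.
have linc j : linear (fun y => l y 0 j : R) by move=> a x y; rewrite linearP !mxE.
pose c j : {linear W -> R} :=
  HB.pack (fun y => l y 0 j : R) (GRing.isLinear.Build _ _ _ _ _ (linc j)).
have cc j : continuous (c j).
  move=> y; apply: (@continuous_comp _ _ _ l (fun x : 'rV[R]_m => x 0 j)).
    exact: cl.
  exact: coord_continuous.
have dij i j := derive_linear_comp z (cc j)
  (smooth_on_differentiable (smooth_on_derive (delta_mx 0 i) sf) Uu).
have E i j : (fun y => jac l f y i j) = c j \o 'D_(delta_mx 0 i) f.
  by apply/funext => y; rewrite mxE.
have dj : derivable (jac l f) u z.
  apply/derivable_mxP => i j; rewrite E; apply: diff_derivable.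
  exact: (dij i j).1.
split=> //; rewrite derive_mx //; apply/matrixP => i j.
rewrite mxE E (dij i j).2 (derive_symmetric _ _ (cc j) oU Uu sf).
by rewrite mxE.
Qed.

End Jacobian.

(** * Metric, symplectic form and null coordinates *)

Section MetricCalculus.
Context {R : realType} {n : nat}.

Definition dot (a b : 'rV[R]_n) : R := \sum_(j < n) a 0 j * b 0 j.

Lemma DmetricE (v w : Dspace R n) : Dmetric v w = dot v.1 w.1 - dot v.2 w.2.
Proof. by rewrite /Dmetric /dot -sumrB. Qed.

Lemma is_derive_dot (V : normedModType R) (Y Z : V -> 'rV[R]_n) x v :
  derivable Y x v -> derivable Z x v ->
  is_derive x v (fun y => dot (Y y) (Z y))
    (dot ('D_v Y x) (Z x) + dot (Y x) ('D_v Z x)).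
Proof.
move=> dY dZ.
have D (A : V -> 'rV[R]_n) j : derivable A x v ->
    is_derive x v (fun y => A y 0 j) ('D_v A x 0 j).
  move=> dA; apply: DeriveDef; first exact: ((derivable_mxP _ _ _).1 dA).
  by rewrite derive_mx // mxE.
have H j : is_derive x v (fun y => Y y 0 j * Z y 0 j)
    (Y x 0 j * 'D_v Z x 0 j + Z x 0 j * 'D_v Y x 0 j).
  exact: is_deriveM (D Y j dY) (D Z j dZ).
refine (is_derive_eq (is_derive_big_sum (index_enum _) H) _).
by rewrite /dot -big_split /=; apply: eq_bigr => j _; rewrite addrC [Z x 0 j * _]mulrC.
Qed.

Lemma is_derive_Dmetric (V : normedModType R) (Y Z : V -> Dspace R n) x v :
  differentiable Y x -> differentiable Z x ->
  is_derive x v (fun y => Dmetric (Y y) (Z y))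
    (Dmetric ('D_v Y x) (Z x) + Dmetric (Y x) ('D_v Z x)).
Proof.
move=> dY dZ.
have D1 (A : V -> Dspace R n) : differentiable A x ->
    derivable (fst \o A) x v /\ 'D_v (fst \o A) x = ('D_v A x).1.
  move=> dA; have c1 : continuous (fst : Dspace R n -> 'rV[R]_n).
    by move=> ?; exact: cvg_fst.
  have [dd E] := derive_linear_comp v c1 dA.
  by split; [exact: diff_derivable|exact: E].
have D2 (A : V -> Dspace R n) : differentiable A x ->
    derivable (snd \o A) x v /\ 'D_v (snd \o A) x = ('D_v A x).2.
  move=> dA; have c1 : continuous (snd : Dspace R n -> 'rV[R]_n).
    by move=> ?; exact: cvg_snd.
  have [dd E] := derive_linear_comp v c1 dA.
  by split; [exact: diff_derivable|exact: E].
have [Y1 Y1E] := D1 _ dY; have [Y2 Y2E] := D2 _ dY.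
have [Z1 Z1E] := D1 _ dZ; have [Z2 Z2E] := D2 _ dZ.
have -> : (fun y => Dmetric (Y y) (Z y)) =
  (fun y => dot ((fst \o Y) y) ((fst \o Z) y)) -
  (fun y => dot ((snd \o Y) y) ((snd \o Z) y)).
  by apply/funext => y; rewrite DmetricE.
refine (is_derive_eq (is_deriveB (is_derive_dot Y1 Z1) (is_derive_dot Y2 Z2)) _).
rewrite Y1E Y2E Z1E Z2E !DmetricE /=; ring.
Qed.

Lemma paraJ_linear : linear (@paraJ R n).
Proof. by []. Qed.

HB.instance Definition _ :=
  GRing.isLinear.Build R (Dspace R n) (Dspace R n) _ (@paraJ R n) paraJ_linear.

Lemma paraJ_continuous : continuous (@paraJ R n).
Proof.
move=> x; apply: (@cvg_pair _ _ _ _ (nbhs x.2) (nbhs x.1)); last exact: cvg_fst.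
exact: cvg_snd.
Qed.

Lemma is_derive_Domega (V : normedModType R) (Y Z : V -> Dspace R n) x v :
  differentiable Y x -> differentiable Z x ->
  is_derive x v (fun y => Domega (Y y) (Z y))
    (Domega ('D_v Y x) (Z x) + Domega (Y x) ('D_v Z x)).
Proof.
move=> dY dZ; have [dJ JE] := derive_linear_comp v paraJ_continuous dZ.
by refine (is_derive_eq (is_derive_Dmetric v dY dJ) _); rewrite JE.
Qed.

End MetricCalculus.

Section NullCoordinates.
Context {R : realType} {n : nat}.

(** Multiplication by [tau] has eigenvalues 1 and -1; [null_plus] and [null_minus]
    are the coordinates of a vector in the two eigenspaces, both isotropic for the
    metric. *)
Definition null_plus (v : Dspace R n) : 'rV[R]_n := v.1 + v.2.
Definition null_minus (v : Dspace R n) : 'rV[R]_n := v.1 - v.2.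

Lemma null_plus_linear : linear null_plus.
Proof. by move=> a x y; rewrite /null_plus /= scalerDr addrACA. Qed.

Lemma null_minus_linear : linear null_minus.
Proof. by move=> a x y; rewrite /null_minus /= scalerBr opprD addrACA. Qed.

HB.instance Definition _ := GRing.isLinear.Build R (Dspace R n) 'rV[R]_n _
  null_plus null_plus_linear.
HB.instance Definition _ := GRing.isLinear.Build R (Dspace R n) 'rV[R]_n _
  null_minus null_minus_linear.

Lemma null_plus_continuous : continuous null_plus.
Proof. by move=> x; apply: cvgD; [exact: cvg_fst|exact: cvg_snd]. Qed.

Lemma null_minus_continuous : continuous null_minus.
Proof. by move=> x; apply: cvgB; [exact: cvg_fst|exact: cvg_snd]. Qed.

Lemma null_eq0 (v : Dspace R n) : null_plus v = 0 -> null_minus v = 0 -> v = 0.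
Proof.
case: v => x y; rewrite /null_plus /null_minus /= => p m.
have E j : x 0 j = 0 /\ y 0 j = 0.
  move/rowP: p => /(_ j); move/rowP: m => /(_ j); rewrite !mxE => p m.
  by split; lra.
by congr (_, _); apply/rowP => j; rewrite mxE; have [] := E j.
Qed.

Lemma dotE (a b : 'rV[R]_n) : dot a b = (a *m b^T) 0 0.
Proof. by rewrite mxE; apply: eq_bigr => j _; rewrite mxE. Qed.

(** The null components enter through equations, so that values computed for them
    can be supplied without rewriting inside derivatives. *)
Lemma Dmetric_null (v w : Dspace R n) vp vm wp wm :
  null_plus v = vp -> null_minus v = vm -> null_plus w = wp -> null_minus w = wm ->
  Dmetric v w = (dot vp wm + dot vm wp) / 2.
Proof.
move=> <- <- <- <-.
rewrite /Dmetric /dot -big_split /= mulr_suml; apply: eq_bigr => j _.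
by rewrite /null_plus /null_minus !mxE; field.
Qed.

Lemma Domega_null (v w : Dspace R n) vp vm wp wm :
  null_plus v = vp -> null_minus v = vm -> null_plus w = wp -> null_minus w = wm ->
  Domega v w = (dot vm wp - dot vp wm) / 2.
Proof.
move=> <- <- <- <-.
rewrite /Domega /Dmetric /dot -sumrB /= mulr_suml; apply: eq_bigr => j _.
by rewrite /null_plus /null_minus !mxE; field.
Qed.

Lemma dot0P (a : 'rV[R]_n) : (forall b, dot a b = 0) -> a = 0.
Proof.
move=> h; apply/rowP => j; rewrite mxE -(h (delta_mx 0 j)) /dot.
rewrite (bigD1 j) //= mxE !eqxx mulr1 big1 ?addr0 // => i ij.
by rewrite mxE (negbTE ij) mulr0.
Qed.

Lemma Dmetric_suml (v : 'I_n -> Dspace R n) (e : 'I_n -> R) (w : Dspace R n) :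
  Dmetric (\sum_i e i *: v i) w = \sum_i e i * Dmetric (v i) w.
Proof.
have add a b : Dmetric (a + b) w = Dmetric a w + Dmetric b w.
  rewrite /Dmetric -big_split; apply: eq_bigr => j _ /=; rewrite !mxE; ring.
have scale a b : Dmetric (a *: b) w = a * Dmetric b w.
  rewrite /Dmetric mulr_sumr; apply: eq_bigr => j _ /=; rewrite !mxE; ring.
have zero : Dmetric 0 w = 0 by rewrite -(scale0r 0) scale mul0r.
by elim/big_ind2 : _ => // a b c d <- <-; exact: add.
Qed.

Lemma DmetricBl (v v' w : Dspace R n) :
  Dmetric (v - v') w = Dmetric v w - Dmetric v' w.
Proof.
rewrite /Dmetric -sumrB; apply: eq_bigr => j _ /=; rewrite !mxE; ring.
Qed.

Lemma Domega_flip (a b b' c d d' : Dspace R n) :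
  Domega a b + Domega c d = 0 -> b = b' -> d = d' -> Domega a b' = - Domega c d'.
Proof. by move=> /eqP + <- <-; rewrite addr_eq0 => /eqP. Qed.

End NullCoordinates.

(** * Real symmetric matrices *)

Section SymmetricForms.
Context {R : realType}.

Lemma form_eq n (A B : 'M[R]_n) :
  (forall x y : 'rV[R]_n, (x *m A *m y^T) 0 0 = (x *m B *m y^T) 0 0) -> A = B.
Proof.
move=> h; apply/matrixP => i j; have := h (delta_mx 0 i) (delta_mx 0 j).
by rewrite trmx_delta -!rowE -!colE !mxE.
Qed.

Lemma congruence_entry n (W G : 'M[R]_n) i j :
  (W *m G *m W^T) i j = (row i W *m G *m (row j W)^T) 0 0.
Proof.
by rewrite -row_mul mxE [RHS]mxE; apply: eq_bigr => k _; rewrite !mxE.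
Qed.

(** By polarization, a symmetric form that vanishes on the diagonal is zero. *)
Lemma symmetric_anisotropic_vector n (G : 'M[R]_n) : G^T = G -> G != 0 ->
  exists x : 'rV[R]_n, (x *m G *m x^T) 0 0 != 0.
Proof.
move=> sG G0; apply: contrapT => noex.
have iso (x : 'rV[R]_n) : (x *m G *m x^T) 0 0 = 0.
  by apply/eqP; apply: contrapT => /negP ?; apply: noex; exists x.
case/eqP: G0; apply/matrixP => i j; rewrite [RHS]mxE.
have := iso (delta_mx 0 i + delta_mx 0 j).
have E (a b : 'I_n) :
    ((delta_mx 0 a : 'rV[R]_n) *m G *m (delta_mx 0 b : 'rV[R]_n)^T) 0 0 = G a b.
  by rewrite trmx_delta -rowE -colE !mxE.
rewrite linearD /= !mulmxDl !mulmxDr 2!mxE [X in _ + X]mxE !E.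
have := iso (delta_mx 0 i); have := iso (delta_mx 0 j); rewrite !E => -> ->.
by rewrite -{2}sG mxE add0r addr0 -mulr2n => /eqP; rewrite mulrn_eq0 /= => /eqP.
Qed.

Lemma symmetric_congruent_diag n (G : 'M[R]_n) : G^T = G ->
  exists2 P : 'M[R]_n, P \in unitmx & is_diag_mx (P *m G *m P^T).
Proof.
elim: n G => [|n IH] G sG.
  by exists 1%:M; [exact: unitmx1|apply/is_diag_mxP => -[]].
have [->|G0] := eqVneq G 0.
  exists 1%:M; first exact: unitmx1.
  by apply/is_diag_mxP => i j _; rewrite mulmx0 mul0mx mxE.
have [x xGx] := symmetric_anisotropic_vector sG G0.
have x0 : x != 0 by apply: contraNneq xGx => ->; rewrite !mul0mx mxE.
(* the first row of Q is proportional to x *)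
pose Q : 'M[R]_(1 + n) := row_ebase x; have uQ : Q \in unitmx := row_ebase_unit x.
pose G1 : 'M[R]_(1 + n) := Q *m (G : 'M[R]_(1 + n)) *m Q^T.
have sG1 : G1^T = G1 by rewrite /G1 !trmx_mul trmxK sG mulmxA.
have a0 : G1 0 0 != 0.
  apply: contraNneq xGx => a0.
  have rx : \rank x = 1%N.
    apply/eqP; rewrite eqn_leq rank_leq_row lt0n mxrank_eq0.
    exact: x0.
  have -> : x = (col_ebase x) 0 0 *: (delta_mx 0 0 *m Q).
    rewrite -{1}(mulmx_ebase x) rx [col_ebase x]mx11_scalar !mul_scalar_mx mxE.
    rewrite -scalemxAl; congr (_ *: (_ *m _)).
    by apply/rowP => j; rewrite !mxE /= ?andbT; case: j => -[].
  rewrite linearZ /= -!scalemxAl -scalemxAr trmx_mul !mulmxA.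
  rewrite -(mulmxA _ Q) -(mulmxA _ (Q *m G)) -/G1.
  move: (G1) a0 => H a0.
  by rewrite trmx_delta -rowE -colE !mxE a0 !mulr0.
have G1E : G1 = Q *m (G : 'M[R]_(1 + n)) *m Q^T by [].
clearbody G1; pose a := G1 0 0; pose b := ursubmx G1; pose D := drsubmx G1.
have dl : dlsubmx G1 = b^T by rewrite trmx_ursub sG1.
have ul : ulsubmx G1 = a%:M.
  apply/matrixP => i j; rewrite !ord1 !mxE eqxx mulr1n.
  by congr (G1 _ _); apply/val_inj.
have sD : D^T = D by rewrite trmx_drsub sG1.
(* clear the first row and column; the Schur complement of a remains *)
have [] := IH (D - a^-1 *: (b^T *m b)).
  by rewrite linearB linearZ /= trmx_mul trmxK sD.
move=> P uP dP.
pose S : 'M[R]_(1 + n) := block_mx 1%:M 0 (- a^-1 *: (P *m b^T)) P.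
have uS : S \in unitmx by rewrite unitmxE det_lblock det1 mul1r -unitmxE.
exists (S *m Q).
  by rewrite unitmx_mul uQ andbT.
have -> : S *m Q *m G *m (S *m Q)^T = S *m G1 *m S^T.
  by rewrite G1E trmx_mul !mulmxA.
have -> : S *m G1 *m S^T =
    block_mx a%:M 0 0 (P *m (D - a^-1 *: (b^T *m b)) *m P^T).
  rewrite -[G1]submxK dl ul -/b -/D /S tr_block_mx !mulmx_block.
  rewrite !trmx1 !trmx0 !mul1mx !mul0mx !mulmx1 !mulmx0 !addr0.
  have z : - a^-1 *: (P *m b^T) *m a%:M + P *m b^T = 0.
    by rewrite -scalemxAl mul_mx_scalar scalerA mulNr mulVf // scaleN1r addNr.
  rewrite z mul0mx add0r; congr block_mx.
    rewrite linearZ /= trmx_mul trmxK -scalemxAr mul_scalar_mx scalerA mulNr.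
    rewrite mulVf //.
    by rewrite scaleN1r addNr.
  rewrite mulmxBr; congr (_ *m _); rewrite addrC; congr (_ + _).
  by rewrite -scalemxAl -scalemxAr scaleNr mulmxA.
have : is_diag_mx (block_mx (a%:M : 'M[R]_1) 0 0
    (P *m (D - a^-1 *: (b^T *m b)) *m P^T)).
  by rewrite is_diag_block_mx // !eqxx /= dP andbT; exact: mx11_is_diag.
exact.
Qed.

(** Sylvester normal form, used for the existence of orthonormal frames. *)
Lemma symmetric_congruent_signs n (G : 'M[R]_n) : G^T = G -> G \in unitmx ->
  exists (W : 'M[R]_n) (e : 'rV[R]_n),
    W *m G *m W^T = diag_mx e /\ forall i, e 0 i = 1 \/ e 0 i = -1.
Proof.
move=> sG uG; have [P uP /is_diag_mxP dP] := symmetric_congruent_diag sG.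
pose d := \row_i (P *m G *m P^T) i i.
have dE : P *m G *m P^T = diag_mx d.
  apply/matrixP => i j; rewrite [RHS]mxE; have [->|ij] := eqVneq i j.
    by rewrite mulr1n [RHS]mxE.
  by rewrite mulr0n; apply: dP.
clearbody d.
have ud : diag_mx d \in unitmx by rewrite -dE !unitmx_mul unitmx_tr uP uG.
have d0 i : d 0 i != 0.
  move: ud; rewrite unitmxE det_diag unitfE => /prodf_neq0 /(_ i); exact.
pose s := \row_i (Num.sqrt `|d 0 i|)^-1.
exists (diag_mx s *m P), (\row_i Num.sg (d 0 i)); split.
  rewrite trmx_mul !mulmxA -(mulmxA _ P) -(mulmxA _ (P *m G)) dE tr_diag_mx.
  apply/matrixP => i j; rewrite (mul_mx_diag _ s) mxE mul_mx_diag !mxE.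
  have [->|ij] := eqVneq i j; last by rewrite !mulr0n !mul0r.
  rewrite !mulr1n {2}(numEsg (d 0 j)).
  have sq : Num.sqrt `|d 0 j| != 0 by rewrite sqrtr_eq0 -ltNge normr_gt0.
  rewrite -{2}(sqr_sqrtr (normr_ge0 (d 0 j))).
  by field.
move=> i; rewrite mxE; have := d0 i; case: sgrP => // _ _; [by left|by right].
Qed.

Lemma signs_inverse n (W G : 'M[R]_n) (e : 'rV[R]_n) :
  W *m G *m W^T = diag_mx e -> (forall i, e 0 i = 1 \/ e 0 i = -1) ->
  W \in unitmx /\ W^T *m diag_mx e *m W *m G = 1%:M.
Proof.
move=> WGW he.
have ee : diag_mx e *m diag_mx e = 1%:M.
  apply/matrixP => i j; rewrite mul_diag_mx !mxE; have [->|ij] := eqVneq i j.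
    by rewrite !mulr1n; case: (he j) => ->; rewrite ?mulrNN mulr1.
  by rewrite !mulr0n mulr0.
have uW : W \in unitmx.
  have : W *m (G *m W^T *m diag_mx e) = 1%:M by rewrite !mulmxA WGW.
  by case/mulmx1_unit.
split=> //; apply: (can_inj (mulmxK (_ : W^T \in unitmx))).
  by rewrite unitmx_tr.
by rewrite mul1mx -!mulmxA (mulmxA W) WGW ee mulmx1.
Qed.

(** The trace of the form [X] with respect to the metric [G], computed in the
    orthonormal frame given by the rows of [W]; the right-hand side shows that it
    does not depend on the frame. *)
Lemma trace_signs n (W G X : 'M[R]_n) (e : 'rV[R]_n) :
  W *m G *m W^T = diag_mx e -> (forall i, e 0 i = 1 \/ e 0 i = -1) ->
  \sum_i e 0 i * (row i W *m X *m (row i W)^T) 0 0 = \tr (invmx G *m X).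
Proof.
move=> WGW he; have [uW WeW] := signs_inverse WGW he.
have uG : G \in unitmx by have [] := mulmx1_unit WeW.
have -> : invmx G = W^T *m diag_mx e *m W.
  by apply: (can_inj (mulmxK uG)); rewrite mulVmx // WeW.
transitivity (\tr (diag_mx e *m (W *m X *m W^T))); last first.
  by rewrite -!mulmxA [in RHS]mxtrace_mulC -!mulmxA.
apply: eq_bigr => i _; rewrite mul_diag_mx [RHS]mxE; congr (_ * _).
by rewrite -row_mul mxE [RHS]mxE; apply: eq_bigr => j _; rewrite !mxE.
Qed.

End SymmetricForms.

(** * Change of chart *)

Section Charts.
Context {R : realType} {n k : nat} {M : topologicalType} {F : M -> Dspace R n}.

(** The transition [h] between two charts is continuous because charts are
    homeomorphisms.  A left inverse [P] of the differential of [F \o phi] turns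
    [F \o phi \o h = F \o psi] into an equation to which
    [differentiable_local_inverse] applies. *)
Lemma chart_transition (U V : set 'rV[R]_k) (phi psi : 'rV[R]_k -> M) u v :
  is_chart F U phi -> is_chart F V psi -> U u -> V v -> phi u = psi v ->
  exists h : 'rV[R]_k -> 'rV[R]_k,
    [/\ h v = u, (\forall y \near v, U (h y) /\ phi (h y) = psi y),
        differentiable h v &
        forall w, 'd (F \o psi) v w = 'd (F \o phi) u ('d h v w)].
Proof.
move=> [oU cphi iphi ophi [sphi dphi]] [oV cpsi ipsi opsi [spsi dpsi]] Uu Vv uv.
pose h y := xget u [set x | U x /\ phi x = psi y].
have cv : psi @ v --> psi v := cpsi v Vv.
have near_h (A : set 'rV[R]_k) : open A -> A `<=` U -> A u ->
    \forall y \near v, A (h y) /\ phi (h y) = psi y.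
  move=> oA AU Au.
  have nA : nbhs (psi v) (phi @` A).
    by apply: open_nbhs_nbhs; split; [exact: ophi|exists u].
  have nv : nbhs v (psi @^-1` (phi @` A)) := cv _ nA.
  apply: filterS nv => y [x Ax xy].
  have [Uh hy] : U (h y) /\ phi (h y) = psi y.
    apply: (@xgetI _ u [set x | U x /\ phi x = psi y] x).
    by split => //; exact: AU.
  by split=> //; rewrite (iphi (h y) x) //; [exact: AU|rewrite hy].
have hv : h v = u.
  have [Uh hE] := nbhs_singleton (near_h U oU (@subset_refl _ _) Uu).
  by apply: iphi => //; rewrite hE.
have ch : {for v, continuous h}.
  move=> A; rewrite hv nbhsE => -[B [oB Bu] BA].
  apply: filterS (near_h (B `&` U) (openI oB oU) (@subIsetr _ _ _) (conj Bu Uu)).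
  by move=> y [[By _] _]; exact: BA.
have nh := near_h U oU (@subset_refl _ _) Uu.
have df : differentiable (F \o phi) u := sphi [::] u Uu.
have dg : differentiable (F \o psi) v := spsi [::] v Vv.
have [P cP PK] := linear_rV_left_inverse (dphi u Uu).
have dP y : differentiable P y by exact: linear_differentiable.
have dh : differentiable h v.
  apply: (@differentiable_local_inverse _ _ _
    (P \o (F \o phi)) (P \o (F \o psi))) => //.
  - by rewrite hv; apply: differentiable_comp.
  - by rewrite hv diff_comp // diff_lin //; apply/funext => x /=; rewrite PK.
  - exact: differentiable_comp.
  - by apply: filterS nh => y [_ /= ->].
exists h; split=> // w.
have fh : differentiable (F \o phi) (h v) by rewrite hv.
have E : 'D_w (F \o psi) v = 'D_w ((F \o phi) \o h) v.
  by apply: near_eq_derive; apply: filterS nh => y [_ /= ->].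
have E1 := deriveE w dg.
have E2 := deriveE w (differentiable_comp dh fh).
have E3 : 'd ((F \o phi) \o h) v w = ('d (F \o phi) (h v) \o 'd h v) w.
  exact: (f_equal (@^~ w) (diff_comp dh fh)).
move: E3; rewrite hv => E3.
exact: (etrans (esym E1) (etrans E (etrans E2 E3))).
Qed.

(** The differential of any other chart through the point factors through that of
    [phi], by [chart_transition]. *)
Lemma tangentP (U : set 'rV[R]_k) (phi : 'rV[R]_k -> M) u X :
  is_chart F U phi -> U u ->
  tangent k F (phi u) X <-> exists w, 'd (F \o phi) u w = X.
Proof.
move=> Uc Uu; split=> [[V [psi [v [w [Vc Vv vu wX]]]]]|[w wX]].
  have [h [_ _ _ hE]] := chart_transition Uc Vc Uu Vv (esym vu).
  by exists ('d h v w); exact: etrans (esym (hE w)) wX.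
by exists U, phi, u, w.
Qed.

End Charts.

(** * Lagrangian immersions in a chart *)

Section NullJacobians.
Context {R : realType} {n : nat}.
Implicit Types f : 'rV[R]_n -> Dspace R n.

Definition null_ratio f u : R :=
  \det (jac (@null_plus R n) f u) / \det (jac (@null_minus R n) f u).

(** The logarithmic derivative of [null_ratio f] along [z], by Jacobi's formula. *)
Definition angle_form f u z : R :=
  \tr (jac (@null_plus R n) ('D_z f) u *m invmx (jac (@null_plus R n) f u)) -
  \tr (jac (@null_minus R n) ('D_z f) u *m invmx (jac (@null_minus R n) f u)).

End NullJacobians.

Section ChartGeometry.
Context {R : realType} {n : nat} {M : topologicalType} {L : M -> Dspace R n}.
Context (L_lagrangian : is_lagrangian L).
Context (L_nondegenerate : nondegenerate_metric n L).
Context {U : set 'rV[R]_n} {phi : 'rV[R]_n -> M}.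
Context (chart : is_chart L U phi).

Local Notation f := (L \o phi).
Local Notation Ap := (jac (@null_plus R n) f).
Local Notation Am := (jac (@null_minus R n) f).

Lemma chart_smooth : smooth_on U f.
Proof. by have [_ _ _ _ []] := chart. Qed.

Lemma chart_open : open U.
Proof. by have [] := chart. Qed.

Lemma chart_differentiable u : U u -> differentiable f u.
Proof. by move=> Uu; exact: smooth_on_differentiable chart_smooth Uu. Qed.

Lemma chart_injective u x : U u -> 'D_x f u = 0 -> x = 0.
Proof.
move=> Uu E; have [_ _ _ _ [_ inj]] := chart; apply: (inj u Uu).
rewrite linear0; exact: etrans (esym (deriveE x (chart_differentiable Uu))) E.
Qed.

Lemma tangentDP u X : U u -> tangent n L (phi u) X <-> exists w, 'D_w f u = X.
Proof.
move=> Uu; split => [/(tangentP _ chart Uu)[w E]|[w E]].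
  by exists w; exact: etrans (deriveE w (chart_differentiable Uu)) E.
apply/(tangentP _ chart Uu); exists w.
exact: etrans (esym (deriveE w (chart_differentiable Uu))) E.
Qed.

Lemma tangent_chart u w : U u -> tangent n L (phi u) ('D_w f u).
Proof. by move=> Uu; apply/tangentDP => //; exists w. Qed.

Lemma null_plus_chart u x : U u -> null_plus ('D_x f u) = x *m Ap u.
Proof. by move=> Uu; apply: jacP; exact: chart_differentiable. Qed.

Lemma null_minus_chart u x : U u -> null_minus ('D_x f u) = x *m Am u.
Proof. by move=> Uu; apply: jacP; exact: chart_differentiable. Qed.

(** The Lagrangian condition in null coordinates: the symmetric part of
    [Ap u *m (Am u)^T] represents the metric, and its antisymmetric part the
    symplectic form up to sign. *)
Lemma gram_symmetric u : U u -> (Ap u *m (Am u)^T)^T = Ap u *m (Am u)^T.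
Proof.
move=> Uu; rewrite trmx_mul trmxK; apply: form_eq => x y.
have := L_lagrangian.2 _ _ _ (tangent_chart x Uu) (tangent_chart y Uu).
rewrite (Domega_null (null_plus_chart x Uu) (null_minus_chart x Uu)
                      (null_plus_chart y Uu) (null_minus_chart y Uu)) !dotE.
rewrite !trmx_mul !mulmxA => /eqP; rewrite mulf_eq0 invr_eq0 pnatr_eq0 orbF.
by rewrite subr_eq0 => /eqP.
Qed.

Lemma gramE u x y : U u ->
  Dmetric ('D_x f u) ('D_y f u) = (x *m (Ap u *m (Am u)^T) *m y^T) 0 0.
Proof.
move=> Uu; have sG := gram_symmetric Uu.
rewrite (Dmetric_null (null_plus_chart x Uu) (null_minus_chart x Uu)
                       (null_plus_chart y Uu) (null_minus_chart y Uu)).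
rewrite !dotE !trmx_mul.
rewrite !mulmxA -(mulmxA x (Am u)) -{2}[Am u]trmxK -trmx_mul sG !mulmxA.
by field.
Qed.

Lemma gram_unit u : U u -> Ap u *m (Am u)^T \in unitmx.
Proof.
move=> Uu; rewrite -row_free_unit -kermx_eq0; apply/rowV0P => x /sub_kermxP xG.
apply: (chart_injective Uu); apply: (L_nondegenerate (tangent_chart x Uu)) => Y.
by move=> /(tangentDP _ Uu)[y <-]; rewrite (gramE _ _ Uu) xG mul0mx mxE.
Qed.

Lemma jac_plus_unit u : U u -> Ap u \in unitmx.
Proof. by move=> /gram_unit; rewrite unitmx_mul => /andP[]. Qed.

Lemma jac_minus_unit u : U u -> Am u \in unitmx.
Proof. by move=> /gram_unit; rewrite unitmx_mul unitmx_tr => /andP[]. Qed.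

Lemma normal_part_normal u v : U u ->
  normal n L (phi u) (normal_part n L (phi u) v) /\
  tangent n L (phi u) (v - normal_part n L (phi u) v).
Proof.
move=> Uu; apply: (@xgetPex _ 0
  [set N | normal n L (phi u) N /\ tangent n L (phi u) (v - N)]).
(* b represents the functional [Dmetric v] on coordinate vectors; solving with
   the Gram matrix gives the coordinates x of the tangential part of v *)
pose b := 2^-1 *: (null_plus v *m (Am u)^T + null_minus v *m (Ap u)^T).
pose x := b *m invmx (Ap u *m (Am u)^T).
exists (v - 'D_x f u); split; last by rewrite opprB addrC subrK; exact: tangent_chart.
move=> _ /(tangentDP _ Uu)[y <-].
rewrite DmetricBl (gramE x y Uu) /x mulmxKV ?gram_unit //.
rewrite (Dmetric_null (erefl (null_plus v)) (erefl (null_minus v))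
                       (null_plus_chart y Uu) (null_minus_chart y Uu)).
rewrite !dotE !trmx_mul /b.
rewrite -scalemxAl (mulmxDl (null_plus v *m _)) !mulmxA.
by rewrite [X in _ - X]mxE [X in _ - _ * X]mxE [_ / 2]mulrC subrr.
Qed.

(** The tangent space and its image under [paraJ] together span D^n, and a vector
    orthogonal to both vanishes. *)
Lemma normal_eq0 u N : U u -> normal n L (phi u) N ->
  (forall z, Domega N ('D_z f u) = 0) -> N = 0.
Proof.
move=> Uu nN oN.
have E z : dot (null_plus N) (z *m Am u) = 0 /\ dot (null_minus N) (z *m Ap u) = 0.
  have := nN _ (tangent_chart z Uu); have := oN z.
  rewrite (Dmetric_null (erefl (null_plus N)) (erefl (null_minus N))
                         (null_plus_chart z Uu) (null_minus_chart z Uu)).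
  rewrite (Domega_null (erefl (null_plus N)) (erefl (null_minus N))
                        (null_plus_chart z Uu) (null_minus_chart z Uu)).
  by move: (dot _ _) (dot _ _) => p q h1 h2; split; lra.
apply: null_eq0; apply: dot0P => b.
  by rewrite -(mulmxKV (jac_minus_unit Uu) b); exact: (E _).1.
by rewrite -(mulmxKV (jac_plus_unit Uu) b); exact: (E _).2.
Qed.

Lemma orthonormal_frameP u (e : 'I_n -> Dspace R n) : U u ->
  orthonormal_frame L (phi u) e ->
  exists (W : 'M[R]_n) (s : 'rV[R]_n),
   [/\ forall i, e i = 'D_(row i W) f u, forall i, s 0 i = Dmetric (e i) (e i),
    forall i, s 0 i = 1 \/ s 0 i = -1 &
    W *m (Ap u *m (Am u)^T) *m W^T = diag_mx s].
Proof.
move=> Uu [te ne oe].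
have /boolp.choice[w wE] : forall i, exists x, 'D_x f u = e i.
  by move=> i; exact/tangentDP.
exists (\matrix_i w i), (\row_i Dmetric (e i) (e i)); split => [i|i|i|].
- by rewrite rowK.
- by rewrite mxE.
- by rewrite mxE.
have E i j : Dmetric (e i) (e j) =
    ((\matrix_i w i) *m (Ap u *m (Am u)^T) *m (\matrix_i w i)^T) i j.
  by rewrite congruence_entry !rowK -!wE; exact: gramE.
apply/matrixP => i j; rewrite -E [RHS]mxE.
by have [->|ij] := eqVneq i j; [rewrite mulr1n mxE|rewrite oe].
Qed.

Lemma orthonormal_frame_exists u : U u ->
  exists e : 'I_n -> Dspace R n, orthonormal_frame L (phi u) e.
Proof.
move=> Uu; have [W [s [WGW hs]]] :=
  symmetric_congruent_signs (gram_symmetric Uu) (gram_unit Uu).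
have E i j : Dmetric ('D_(row i W) f u) ('D_(row j W) f u) = diag_mx s i j.
  by rewrite -WGW congruence_entry; exact: gramE.
exists (fun i => 'D_(row i W) f u); split => [i|i|i j ij].
- exact: tangent_chart.
- by rewrite E mxE eqxx mulr1n; exact: hs.
- by rewrite E mxE (negbTE ij) mulr0n.
Qed.

End ChartGeometry.

(** * Second fundamental form and mean curvature *)

Section Curvature.
Context {R : realType} {n : nat} {M : topologicalType} {L : M -> Dspace R n}.
Context (L_lagrangian : is_lagrangian L).
Context (L_nondegenerate : nondegenerate_metric n L).
Context {U : set 'rV[R]_n} {phi : 'rV[R]_n -> M}.
Context (chart : is_chart L U phi).

Local Notation f := (L \o phi).
Local Notation Ap := (jac (@null_plus R n) f).
Local Notation Am := (jac (@null_minus R n) f).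

(** The field [Y], read in the chart [psi], and the coordinate field ['D_z f] of the
    chart [phi] are both tangent, so [Domega] vanishes on them identically;
    differentiate this in the direction [w], through the transition map.  The
    right-hand side depends on [Y] only through its value at [v]: this makes the
    second fundamental form independent of the chart and of the extension. *)
Lemma derive_tangent_field (V : set 'rV[R]_n) (psi : 'rV[R]_n -> M) u v x w z
    (Y : 'rV[R]_n -> Dspace R n) :
  U u -> is_chart L V psi -> V v -> psi v = phi u ->
  'd (L \o psi) v w = 'D_x f u -> tangent_field L V psi Y ->
  Domega ('D_w Y v) ('D_z f u) = - Domega (Y v) ('D_x ('D_z f) u).
Proof.
move=> Uu psic Vv vu wx [sY tY].
have [h [hv nh dh hE]] := chart_transition chart psic Uu Vv (esym vu).
have hx : 'd h v w = x.
  have [_ _ _ _ [_ inj]] := chart; apply: (inj u Uu).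
  apply: etrans (esym (hE w)) _; apply: etrans wx _.
  exact: deriveE x (chart_differentiable chart Uu).
have dz : differentiable ('D_z f) u.
  exact: smooth_on_differentiable (smooth_on_derive z (chart_smooth chart)) Uu.
have dzh : differentiable ('D_z f) (h v) by rewrite hv.
have dzhc := differentiable_comp dh dzh.
have dY : differentiable Y v := smooth_on_differentiable sY Vv.
(* near v both arguments are tangent at psi y = phi (h y) *)
have D0 : is_derive v w (fun y => Domega (Y y) (('D_z f \o h) y)) 0.
  apply: (@near_eq_is_derive _ _ _ (cst (0 : R))).
  have nV : nbhs v V by have [oV _ _ _ _] := psic; move: oV; rewrite openE; apply.
  apply: filterS2 nV nh => y Vy [Uhy hy]; apply/esym.
  apply: (L_lagrangian.2 (psi y)); first exact: tY.
  by rewrite -hy; exact: (tangent_chart chart).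
have E : 'D_w ('D_z f \o h) v = 'D_x ('D_z f) u.
  apply: etrans (deriveE w dzhc) _.
  apply: etrans (f_equal (@^~ w) (diff_comp dh dzh)) _.
  rewrite /= hx hv; exact: esym (deriveE x dz).
have [_ E0] := D0; have [_ E1] := is_derive_Domega w dY dzhc.
exact: Domega_flip (etrans (esym E1) E0) (congr1 ('D_z f) hv) E.
Qed.

(** A normal vector is determined by its [Domega] pairings with tangent vectors, see
    [normal_eq0], so this is a formula for the second fundamental form.  The
    tangential part that the projection removes does not contribute, because the
    tangent space is Lagrangian. *)
Lemma second_form_pairing u x y : U u ->
  normal n L (phi u) (second_form n L (phi u) ('D_x f u) ('D_y f u)) /\
  forall z, Domega (second_form n L (phi u) ('D_x f u) ('D_y f u)) ('D_z f u)
    = - Domega ('D_y f u) ('D_x ('D_z f) u).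
Proof.
move=> Uu.
pose S := [set N | exists (V : set 'rV[R]_n) (psi : 'rV[R]_n -> M) v w
                         (Yt : 'rV[R]_n -> Dspace R n),
     [/\ is_chart L V psi, V v & psi v = phi u] /\
     [/\ 'd (L \o psi) v w = 'D_x f u, tangent_field L V psi Yt, Yt v = 'D_y f u &
         N = normal_part n L (phi u) ('D_w Yt v)]].
have S0 : exists N, S N.
  exists (normal_part n L (phi u) ('D_x ('D_y f) u)), U, phi, u, x, ('D_y f).
  split=> //; split=> //.
    exact: esym (deriveE x (chart_differentiable chart Uu)).
  split; first exact: smooth_on_derive (chart_smooth chart).
  by move=> v Vv; exact: (tangent_chart chart y Vv).
have SF : S (second_form n L (phi u) ('D_x f u) ('D_y f u)) := xgetPex 0 S0.
have [V [psi [v [w [Y [[psic Vv vu] [wx tY Yv NE]]]]]]] := SF; rewrite NE.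
have [nN tN] := normal_part_normal L_lagrangian L_nondegenerate chart ('D_w Y v) Uu.
split=> // z; rewrite -Yv -(derive_tangent_field z Uu psic Vv vu wx tY).
have := L_lagrangian.2 _ _ _ tN (tangent_chart chart z Uu).
by rewrite /Domega DmetricBl => /eqP; rewrite subr_eq0 => /eqP ->.
Qed.

(** Since [angle_form f u z / 2] is the derivative of the Lagrangian angle along
    [z], this is the relation [omega(n H, Z) = - d beta(Z)].  Summing
    [second_form_pairing] over a frame gives the trace of [Am Bp^T - Ap Bm^T] with
    respect to the Gram matrix, [Bp] and [Bm] being the derivatives of [Ap] and [Am]
    along [z]. *)
Lemma mean_curvature_pairing u : U u ->
  normal n L (phi u) (mean_curvature n L (phi u)) /\
  forall z, Domega (mean_curvature n L (phi u)) ('D_z f u) =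
    - (n%:R^-1 * (angle_form f u z / 2)).
Proof.
move=> Uu.
pose S := [set H | exists e : 'I_n -> Dspace R n, orthonormal_frame L (phi u) e /\
     H = n%:R^-1 *:
       \sum_(i < n) Dmetric (e i) (e i) *: second_form n L (phi u) (e i) (e i)].
have S0 : exists H, S H.
  have [e oe] := orthonormal_frame_exists L_lagrangian L_nondegenerate chart Uu.
  by eexists; exists e; split; [exact: oe|].
have SH : S (mean_curvature n L (phi u)) := xgetPex 0 S0.
have [e [oe HE]] := SH; rewrite HE.
have [W [s [eE sE hs WGW]]] := orthonormal_frameP L_lagrangian chart Uu oe.
rewrite scaler_sumr; under eq_bigr do rewrite scalerA.
split.
  move=> X tX; rewrite Dmetric_suml big1 // => i _.
  by rewrite eE (second_form_pairing _ _ Uu).1 // mulr0.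
move=> z; rewrite /Domega Dmetric_suml.
pose Bp := jac (@null_plus R n) ('D_z f) u.
pose Bm := jac (@null_minus R n) ('D_z f) u.
pose X := Am u *m Bp^T - Ap u *m Bm^T.
have dz : differentiable ('D_z f) u.
  exact: smooth_on_differentiable (smooth_on_derive z (chart_smooth chart)) Uu.
have E i : Domega (second_form n L (phi u) (e i) (e i)) ('D_z f u) =
   - ((row i W *m X *m (row i W)^T) 0 0 / 2).
  rewrite eE (second_form_pairing _ _ Uu).2; congr (- _).
  rewrite (Domega_null (null_plus_chart chart _ Uu) (null_minus_chart chart _ Uu)
     (jacP (@null_plus R n) _ dz) (jacP (@null_minus R n) _ dz)) !dotE.
  congr (_ / 2).
  rewrite -/Bp -/Bm /X mulmxBr mulmxBl !trmx_mul !mulmxA.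
  by rewrite [RHS]mxE [X in _ = _ + X]mxE.
(* cancelling one Jacobian factor of the symmetric Gram matrix *)
have GV : \tr (invmx (Ap u *m (Am u)^T) *m X) = angle_form f u z.
  have uAp := jac_plus_unit L_lagrangian L_nondegenerate chart Uu.
  have uAm := jac_minus_unit L_lagrangian L_nondegenerate chart Uu.
  have uG := gram_unit L_lagrangian L_nondegenerate chart Uu.
  have sG := gram_symmetric L_lagrangian chart Uu.
  have E1 : invmx (Ap u *m (Am u)^T) *m Am u = (invmx (Ap u))^T.
    apply: (can_inj (mulKmx uG)); rewrite mulmxA mulmxV // mul1mx.
    by rewrite -sG trmx_mul trmxK -mulmxA -trmx_mul mulVmx // trmx1 mulmx1.
  have E2 : invmx (Ap u *m (Am u)^T) *m Ap u = (invmx (Am u))^T.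
    apply: (can_inj (mulKmx uG)); rewrite mulmxA mulmxV // mul1mx.
    by rewrite -mulmxA -trmx_mul mulVmx // trmx1 mulmx1.
  by rewrite /X mulmxBr !mulmxA E1 E2 -!trmx_mul linearB /= !mxtrace_tr.
rewrite -GV -(trace_signs X WGW hs) mulr_suml mulr_sumr -sumrN.
apply: eq_bigr => i _.
have Ei : Dmetric (second_form n L (phi u) (e i) (e i)) (paraJ ('D_z f u)) = _ :=
  E i.
rewrite Ei -sE; move: (s 0 i) (_ 0 0) => a b; ring.
Qed.

Lemma mean_curvature_eq0 u : U u ->
  mean_curvature n L (phi u) = 0 <-> forall z, angle_form f u z = 0.
Proof.
move=> Uu; have [nH HE] := mean_curvature_pairing Uu; split=> [H0 z|t0].
  (* for n = 0 the factor 1 / n is zero, but the traces are empty sums *)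
  have [n0|n0] := eqVneq n 0%N.
    have tr0 (A : 'M[R]_n) : \tr A = 0.
      rewrite /mxtrace big1 // => i _.
      by exfalso; move: (leq_ltn_trans (leq0n i) (ltn_ord i)); rewrite n0.
    by rewrite /angle_form !tr0 subrr.
  have := HE z; rewrite H0 /Domega -(subrr 0) DmetricBl subrr => /esym/eqP.
  rewrite oppr_eq0 mulf_eq0 invr_eq0 pnatr_eq0 (negbTE n0) /=.
  by rewrite mulf_eq0 invr_eq0 pnatr_eq0 orbF => /eqP.
apply: (normal_eq0 L_lagrangian L_nondegenerate chart Uu nH) => z.
by rewrite HE t0 mul0r mulr0 oppr0.
Qed.
End Curvature.

(** * Para-complex argument in null coordinates *)

Section ParaArgument.
Context {R : realType}.
Implicit Types z w : paracomplex R.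

(** The two ring morphisms D -> R that send [tau] to 1 and to -1; together they
    identify D with R x R. *)
Definition para_plus z : R := pRe z + pIm z.
Definition para_minus z : R := pRe z - pIm z.

Lemma para_plus_zmod : zmod_morphism para_plus.
Proof. by case=> a b [c d]; rewrite /para_plus /=; ring. Qed.

Lemma para_minus_zmod : zmod_morphism para_minus.
Proof. by case=> a b [c d]; rewrite /para_minus /=; ring. Qed.

Lemma para_plus_monoid : monoid_morphism para_plus.
Proof.
split; first by rewrite /para_plus /= addr0.
by case=> a b [c d]; rewrite /para_plus /=; ring.
Qed.

Lemma para_minus_monoid : monoid_morphism para_minus.
Proof.
split; first by rewrite /para_minus /= subr0.
by case=> a b [c d]; rewrite /para_minus /=; ring.
Qed.

HB.instance Definition _ :=
  GRing.isZmodMorphism.Build (paracomplex R) R para_plus para_plus_zmod.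
HB.instance Definition _ :=
  GRing.isMonoidMorphism.Build (paracomplex R) R para_plus para_plus_monoid.
HB.instance Definition _ :=
  GRing.isZmodMorphism.Build (paracomplex R) R para_minus para_minus_zmod.
HB.instance Definition _ :=
  GRing.isMonoidMorphism.Build (paracomplex R) R para_minus para_minus_monoid.

Lemma para_null_inj z w : para_plus z = para_plus w ->
  para_minus z = para_minus w -> z = w.
Proof.
case: z w => a b [c d]; rewrite /para_plus /para_minus /= => p m.
by congr ParaComplex; lra.
Qed.

Lemma para_sqnorm_null z : para_sqnorm z = para_plus z * para_minus z.
Proof. by case: z => a b; rewrite /para_sqnorm /para_plus /para_minus /=; ring. Qed.

Lemma para_polar_null (s q : bool) (r t : R) :
  let z := (-1) ^+ s * para_tau R ^+ q * para_real r * para_exp t in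
  para_plus z = (-1) ^+ s * r * expR t /\
  para_minus z = (-1) ^+ s * (-1) ^+ q * r * expR (- t).
Proof.
have pr : para_plus (para_real r) = r by rewrite /para_plus /= addr0.
have mr : para_minus (para_real r) = r by rewrite /para_minus /= subr0.
have pe : para_plus (para_exp t) = expR t by rewrite /para_plus /=; field.
have me : para_minus (para_exp t) = expR (- t) by rewrite /para_minus /=; field.
have pt : para_plus (para_tau R) = 1 by rewrite /para_plus /= add0r.
have mt : para_minus (para_tau R) = -1 by rewrite /para_minus /= sub0r.
split; rewrite !rmorphM /= !rmorphXn /= rmorphN1.
  by rewrite pr pe pt expr1n mulr1.
by rewrite mr me mt.
Qed.

(** In null coordinates [r e^{tau t}] is [(r e^t, r e^-t)], and signs and [tau] only
    change signs of coordinates; hence the ratio of the absolute values is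
    [e^(2 t)]. *)
Lemma is_para_argP z t : para_plus z != 0 -> para_minus z != 0 ->
  is_para_arg z t <-> t = ln `|para_plus z / para_minus z| / 2.
Proof.
move=> p0 m0; set p := para_plus z; set m := para_minus z.
have pm0 : 0 < `|p / m| by rewrite normr_gt0 mulf_neq0 ?invr_eq0.
split=> [[s [q E]]|->].
  have [] := para_polar_null s q (Num.sqrt `|para_sqnorm z|) t.
  rewrite -E -/p -/m para_sqnorm_null -/p -/m.
  set r := Num.sqrt _ => pE mE.
  have r0 : r != 0 by rewrite sqrtr_eq0 -ltNge normr_gt0 mulf_neq0.
  have -> : `|p / m| = expR (2 * t).
    rewrite normrM normfV pE mE !normrM !normr_sign !mul1r.
    rewrite !(gtr0_norm (expR_gt0 _)) expRN invfM invrK mulrACA.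
    rewrite mulfV ?normr_eq0 //.
    by rewrite mul1r -expRD mulr2n mulrDl mul1r.
  by rewrite expRK mulrC mulKf.
(* p < 0 gives the sign, and z needs a factor tau when z * conj z < 0 *)
set t0 := _ / 2; exists (p < 0), (p * m < 0); apply/esym.
set r := Num.sqrt _.
have [pE mE] := para_polar_null (p < 0) (p * m < 0) r t0.
have e2 : expR t0 ^+ 2 = `|p / m|.
  by rewrite -expRM_natl mulrC /t0 divfK // lnK.
have r2 : r ^+ 2 = `|p * m| by rewrite /r sqr_sqrtr // para_sqnorm_null.
have r0 : 0 <= r by exact: sqrtr_ge0.
have rp : r * expR t0 = `|p|.
  apply/eqP; rewrite -(eqrXn2 (n:=2)) // ?mulr_ge0 ?expR_ge0 //.
  rewrite exprMn e2 r2 -normrM; apply/eqP.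
  by rewrite -normrX; congr `| _ |; field.
have rm : r * expR (- t0) = `|m|.
  apply/eqP; rewrite -(eqrXn2 (n:=2)) // ?mulr_ge0 ?expR_ge0 //.
  rewrite exprMn expRN exprVn e2 r2 -normfV -normrM; apply/eqP.
  by rewrite -normrX invf_div [p * m * _]mulrC mulrA divfK.
apply: para_null_inj.
  rewrite pE -mulrA rp -/p [RHS]numEsign; case: (p < 0) => //.
have signs : (p < 0) (+) (p * m < 0) = (m < 0).
  case: (ltgtP p 0) (p0 : p != 0) => [pn _|pp _|//].
    by rewrite nmulr_rlt0 //=; case: (ltgtP m 0) (m0 : m != 0).
  by rewrite pmulr_rlt0.
by rewrite mE -mulrA rm -/m -signr_addb signs [RHS]numEsign.
Qed.

Lemma para_argE z : para_plus z != 0 -> para_minus z != 0 ->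
  para_arg z = ln `|para_plus z / para_minus z| / 2.
Proof.
move=> p0 m0; apply/(is_para_argP _ p0 m0).
apply: (@xgetPex _ 0 [set t | is_para_arg z t]).
by exists (ln `|para_plus z / para_minus z| / 2); apply/is_para_argP.
Qed.

Lemma para_volume_null n (e : 'I_n -> Dspace R n) :
  para_plus (para_volume e) = \det (\matrix_(i, j) null_plus (e i) 0 j) /\
  para_minus (para_volume e) = \det (\matrix_(i, j) null_minus (e i) 0 j).
Proof.
by split; rewrite /para_volume -det_map_mx; congr (\det _); apply/matrixP => i j;
  rewrite !mxE.
Qed.

End ParaArgument.

(** * Lagrangian angle in a chart *)

Section Angle.
Context {R : realType} {n : nat} {M : topologicalType} {L : M -> Dspace R n}.
Context (L_lagrangian : is_lagrangian L).
Context (L_nondegenerate : nondegenerate_metric n L).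
Context {U : set 'rV[R]_n} {phi : 'rV[R]_n -> M}.
Context (chart : is_chart L U phi).

Local Notation f := (L \o phi).
Local Notation Ap := (jac (@null_plus R n) f).
Local Notation Am := (jac (@null_minus R n) f).

Lemma null_ratio_neq0 u : U u -> null_ratio f u != 0.
Proof.
move=> Uu; have := jac_plus_unit L_lagrangian L_nondegenerate chart Uu.
have := jac_minus_unit L_lagrangian L_nondegenerate chart Uu.
by rewrite !unitmxE !unitfE => m p; rewrite mulf_neq0 ?invr_eq0.
Qed.

(** A frame is a real matrix [W] times the coordinate frame, so both null components
    of the volume acquire the same factor [\det W], which cancels in the ratio:
    coordinate vectors may be used in place of an orthonormal frame. *)
Lemma lagrangian_angleE u : U u ->
  lagrangian_angle L (phi u) = ln `|null_ratio f u| / 2.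
Proof.
move=> Uu.
pose S := [set t | exists e : 'I_n -> Dspace R n, orthonormal_frame L (phi u) e /\
     t = para_arg (para_volume e)].
have S0 : exists t, S t.
  have [e oe] := orthonormal_frame_exists L_lagrangian L_nondegenerate chart Uu.
  by eexists; exists e; split; [exact: oe|].
have St : S (lagrangian_angle L (phi u)) := xgetPex 0 S0.
have [e [oe ->]] := St.
have [W [s [eE _ hs WGW]]] := orthonormal_frameP L_lagrangian chart Uu oe.
have [uW _] := signs_inverse WGW hs.
have [pE mE] := para_volume_null e.
have EW (l : Dspace R n -> 'rV[R]_n) (A : 'M[R]_n) :
    (forall x, l ('D_x f u) = x *m A) ->
    \det (\matrix_(i, j) l (e i) 0 j) = \det W * \det A.
  move=> lA; rewrite -det_mulmx; congr (\det _); apply/matrixP => i j.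
  by rewrite mxE eE lA -row_mul mxE.
rewrite (EW _ _ (fun x => null_plus_chart chart x Uu)) in pE.
rewrite (EW _ _ (fun x => null_minus_chart chart x Uu)) in mE.
have W0 : \det W != 0 by move: uW; rewrite unitmxE unitfE.
have p0 : \det (Ap u) != 0.
  have := jac_plus_unit L_lagrangian L_nondegenerate chart Uu.
  by rewrite unitmxE unitfE.
have m0 : \det (Am u) != 0.
  have := jac_minus_unit L_lagrangian L_nondegenerate chart Uu.
  by rewrite unitmxE unitfE.
rewrite para_argE ?pE ?mE ?mulf_neq0 //; congr (ln `| _ | / 2).
by rewrite /null_ratio invfM mulrACA mulfV // mul1r.
Qed.

(** The square replaces the absolute value under the logarithm in
    [lagrangian_angleE] by a differentiable function. *)
Lemma is_derive_null_ratio u z : U u ->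
  is_derive u z (fun y => null_ratio f y ^+ 2)
    (2 * null_ratio f u ^+ 2 * angle_form f u z).
Proof.
move=> Uu.
have uAp := jac_plus_unit L_lagrangian L_nondegenerate chart Uu.
have uAm := jac_minus_unit L_lagrangian L_nondegenerate chart Uu.
have p0 : \det (Ap u) != 0 by move: uAp; rewrite unitmxE unitfE.
have m0 : \det (Am u) != 0 by move: uAm; rewrite unitmxE unitfE.
have [dp Ep] := derive_jac z (@null_plus_continuous R n)
  (chart_open chart) Uu (chart_smooth chart).
have [dm Em] := derive_jac z (@null_minus_continuous R n)
  (chart_open chart) Uu (chart_smooth chart).
have := is_derive_det dp; have := is_derive_det dm.
rewrite Ep Em.
have adjE (A B : 'M[R]_n) : A \in unitmx ->
    \tr (B *m \adj A) = \det A * \tr (B *m invmx A).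
  move=> uA; rewrite /invmx uA -scalemxAr mxtraceZ mulrA mulfV ?mul1r //.
  by move: uA; rewrite unitmxE unitfE.
rewrite !adjE // /angle_form.
set a := \tr (_ *m invmx (Ap u)); set b := \tr (_ *m invmx (Am u)).
move=> dM dP.
have dV : is_derive u z (fun y => (\det (Am y))^-1)
    (- (\det (Am u)) ^- 2 *: (\det (Am u) * b)).
  have [dM1 dM2] := dM.
  by apply: DeriveDef; [exact: derivableV|rewrite deriveV // dM2].
have dQ := is_deriveM dP dV.
have dX := is_deriveX 2 dQ.
refine (is_derive_eq dX _).
have fld (P Q c d : R) : Q != 0 ->
    2 * (P / Q) * (P * (- Q ^- 2 * (Q * d)) + Q^-1 * (P * c))
    = 2 * (P / Q) ^+ 2 * (c - d) by move=> Q0; field.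
exact: fld m0.
Qed.

End Angle.

(** * Minimality and constancy of the angle *)

Lemma connected_locally_constant (M : topologicalType) (T : Type) (f : M -> T) :
  connected [set: M] -> (forall p, \forall q \near p, f q = f p) ->
  forall p q, f p = f q.
Proof.
move=> cM lf p q.
pose B := [set x | f x = f p].
have oB : open B.
  rewrite openE => x Bx; apply: filterS (lf x) => y /= yx.
  exact: etrans yx Bx.
have cB : closed B.
  rewrite -openC openE => x Bx; apply: filterS (lf x) => y /= yx By.
  by apply: Bx; exact: etrans (esym yx) By.
have BT : B = [set: M].
  by apply: cM; [exists p|exists B; rewrite ?setTI|exists B; rewrite ?setTI].
by have : B q by rewrite BT.
Qed.

Theorem corollary1 (R : realType) (n : nat) (M : topologicalType)
    (L : M -> Dspace R n)
    (L_connected : connected [set: M])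
    (L_lagrangian : is_lagrangian L)
    (L_nondegenerate : nondegenerate_metric n L) :
  is_minimal n L <-> exists c : R, forall p : M, lagrangian_angle L p = c.
Proof.
have [[_ _ charts] _] := L_lagrangian.
split=> [minL|[c angleE] p].
  have locc p : \forall q \near p, lagrangian_angle L q = lagrangian_angle L p.
    have [U [phi [u [ch Uu <-]]]] := charts p.
    have oU := chart_open ch.
    have [_ _ _ ophi _] := ch.
    have N : \forall y \near u,
        null_ratio (L \o phi) y ^+ 2 = null_ratio (L \o phi) u ^+ 2.
      apply: (derive0_near_cst oU Uu) => x z Ux.
      have a0 :=
        (mean_curvature_eq0 L_lagrangian L_nondegenerate ch Ux).1 (minL _) z.
      have := is_derive_null_ratio L_lagrangian L_nondegenerate ch z Ux.
      by rewrite a0 mulr0.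
    have nU : nbhs u U by move: oU; rewrite openE; apply.
    have nUN : nbhs u (fun y => U y /\ null_ratio (L \o phi) y ^+ 2 =
        null_ratio (L \o phi) u ^+ 2) by exact: filterI nU N.
    move: nUN; rewrite nbhsE => -[B [oB Bu] Bsub].
    have : nbhs (phi u) (phi @` B).
      apply: open_nbhs_nbhs; split; last by exists u.
      by apply: ophi => // x /Bsub [].
    apply: filterS => _ [x /Bsub [Ux Nx] <-].
    have lnE (a b : R) : a ^+ 2 = b ^+ 2 -> ln `|a| / 2 = ln `|b| / 2.
      by move=> ab; rewrite -!sqrtr_sqr ab.
    apply: etrans (lagrangian_angleE L_lagrangian L_nondegenerate ch Ux) _.
    apply: etrans (lnE _ _ Nx) _.
    exact: esym (lagrangian_angleE L_lagrangian L_nondegenerate ch Uu).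
  have [[p _]|M0] := pselect (exists p : M, True).
    by exists (lagrangian_angle L p) => q; exact: connected_locally_constant.
  by exists 0 => p; exfalso; apply: M0; exists p.
have [U [phi [u [ch Uu <-]]]] := charts p.
apply/(mean_curvature_eq0 L_lagrangian L_nondegenerate ch Uu) => z.
have D := is_derive_null_ratio L_lagrangian L_nondegenerate ch z Uu.
have nU : nbhs u U by have := chart_open ch; rewrite openE; apply.
(* on the whole chart the squared ratio is the constant e^(4 c) *)
have [_ D0] : is_derive u z (fun y => null_ratio (L \o phi) y ^+ 2) 0.
  apply: (@near_eq_is_derive _ _ _ (cst (expR (2 * c) ^+ 2))).
  apply: filterS nU => y Uy; apply/esym.
  have := lagrangian_angleE L_lagrangian L_nondegenerate ch Uy.
  rewrite angleE => /(congr1 (fun t => expR (2 * t))).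
  rewrite [2 * (_ / 2)]mulrC divfK // lnK ?posrE ?normr_gt0; last first.
    exact: (null_ratio_neq0 L_lagrangian L_nondegenerate ch).
  by rewrite /cst => ->; rewrite real_normK // num_real.
have [_ D1] := D.
have /eqP := etrans (esym D1) D0.
rewrite mulf_eq0 => /orP[|/eqP //]; rewrite mulf_eq0 pnatr_eq0 expf_eq0 /=.
by rewrite (negbTE (null_ratio_neq0 L_lagrangian L_nondegenerate ch Uu)).
Qed.
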